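(* Let $0\le p\le 1$. The polarized $2$-SAT problem with polarization $p$ has a sharp satisfiability threshold and $\alpha_2(p,n)=1+o(1)$ as $n\to\infty$. More precisely, for any sequence $m=m(n)$ of positive integers: - if $(n-m)/n^{2/3}\to\infty$, then $\Pr(\Phi_m(n,2,p)\text{ is satisfiable})\to 1$; - if $(m-n)/(n\ln n)^{9/10}\to\infty$, then $\Pr(\Phi_m(n,2,p)\text{ is satisfiable})\to 0$. In other words, $\alpha_2(p):=\lim_{n\to\infty}\alpha_2(p,n)$ exists and equals $1$, the threshold density $\alpha_2$ of classical random $2$-SAT.
   Context: Polarized random $k$-SAT (here $k=2$). For $0\le p\le 1$, $\Phi_m=\Phi_m(n,k,p)$ is the random formula $C_1\wedge\dots\wedge C_m$ on Boolean variables $x_1,\dots,x_n$, where the clauses $C_i$ are independent and each is generated as follows: choose a $k$-tuple $K_i=(v_1,\dots,v_k)$ of distinct indices from $\{1,\dots,n\}$ uniformly at random (i.e. drawn without replacement); independently choose $B_i\in\{-1,1\}$ with $\Pr(B_i=1)=\Pr(B_i=-1)=\frac12$, and independent $P_{i1},\dots,P_{ik}\in\{-1,1\}$ with $\Pr(P_{ij}=1)=p$, $\Pr(P_{ij}=-1)=1-p$; set the literal $z_j=x_{v_j}$ if $B_iP_{ij}=1$ and $z_j=\neg x_{v_j}$ otherwise; and let $C_i=z_1\vee\dots\vee z_k$. The case $p=\frac12$ is classical random $k$-SAT. The median satisfiability threshold is $\alpha_k(p,n):=\min\{m/n:\Pr(\Phi_m(n,k,p)\text{ is satisfiable})\le\frac12\}$.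 The model has a sharp satisfiability threshold if for every $\varepsilon>0$, $\Phi_m$ is satisfiable with probability tending to $1$ (as $n\to\infty$) whenever $m<(\alpha_k(p,n)-\varepsilon)n$, and unsatisfiable with probability tending to $1$ whenever $m>(\alpha_k(p,n)+\varepsilon)n$. *)

(* Defs.v *)
(* MathComp-Analysis development: the reals are an arbitrary [R : realType]. *)
From HB Require Import structures.
From mathcomp Require Import all_boot all_order all_algebra.
From mathcomp Require Import all_classical all_reals all_analysis.

Set Implicit Arguments.
Unset Strict Implicit.
Unset Printing Implicit Defensive.

Import Order.TTheory GRing.Theory Num.Theory.
Import numFieldNormedType.Exports.
Local Open Scope classical_set_scope.
Local Open Scope ring_scope.

(* Variables are indexed by 'I_n; [(v, true)] is the literal x_v and
   [(v, false)] is its negation.  Signs +1 / -1 are encoded as true / false. *)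
Definition literal (n : nat) : Type := ('I_n * bool)%type.
Definition clause (n k : nat) : Type := {ffun 'I_k -> literal n}.
Definition formula (n k m : nat) : Type := {ffun 'I_m -> clause n k}.

Definition satisfiable (n k m : nat) (F : formula n k m) : bool :=
  [exists x : {ffun 'I_n -> bool},
    [forall i : 'I_m, [exists j : 'I_k, x (F i j).1 == (F i j).2]]].

(* The random choices (K, B, P) behind one clause. *)
Definition distinct_tuple (n k : nat) : finType :=
  {K : {ffun 'I_k -> 'I_n} | injectiveb K}.
Definition clause_draw (n k : nat) : finType :=
  (distinct_tuple n k * bool * {ffun 'I_k -> bool})%type.

(* On signs encoded as booleans, the product B * P_j is +1 iff B == P_j. *)
Definition clause_of (n k : nat) (d : clause_draw n k) : clause n k :=
  let: (K, B, P) := d in [ffun j => (val K j, B == P j)].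

Definition formula_of (n k m : nat) (w : {ffun 'I_m -> clause_draw n k}) :
    formula n k m :=
  [ffun i => clause_of (w i)].

(* K is uniform, B is a fair sign and the P_j are independent, equal to +1
   with probability p. *)
Definition draw_prob (R : realType) (n k : nat) (p : R)
    (d : clause_draw n k) : R :=
  let: (_, _, P) := d in
  #|distinct_tuple n k|%:R^-1 * 2^-1 * \prod_(j < k) (if P j then p else 1 - p).

(* Probability that the random formula Phi_m(n, k, p), made of m independent
   clauses, has the property E.  This is a probability when k <= n (see
   [formula_prob_total]); for n < k there is no clause to draw. *)
Definition formula_prob (R : realType) (n k : nat) (p : R) (m : nat)
    (E : formula n k m -> bool) : R :=
  \sum_(w : {ffun 'I_m -> clause_draw n k} | E (formula_of w))
    \prod_(i < m) draw_prob p (w i).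

Definition sat_prob (R : realType) (n k : nat) (p : R) (m : nat) : R :=
  formula_prob p (@satisfiable n k m).

Definition unsat_prob (R : realType) (n k : nat) (p : R) (m : nat) : R :=
  formula_prob p (fun F : formula n k m => ~~ satisfiable F).

(* The infimum is a minimum as soon as the set is nonempty
   (see [median_threshold_min]); it is 0 when the set is empty, which does
   occur for a few small n, e.g. n = k = 2 and p = 1. *)
Definition median_threshold (R : realType) (k : nat) (p : R) (n : nat) : R :=
  inf [set m%:R / n%:R | m in [set m : nat | sat_prob n k p m <= 2^-1]].

(* The conditions on m are required for all large n only: at n = 0 the strict
   inequalities could hold for no m. *)
Definition sharp_sat_threshold (R : realType) (k : nat) (p : R) : Prop :=
  forall eps : R, 0 < eps -> forall m : nat -> nat,
    ((\forall n \near \oo,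
        (m n)%:R < (median_threshold k p n - eps) * n%:R) ->
      sat_prob n k p (m n) @[n --> \oo] --> (1 : R)) /\
    ((\forall n \near \oo,
        (m n)%:R > (median_threshold k p n + eps) * n%:R) ->
      unsat_prob n k p (m n) @[n --> \oo] --> (1 : R)).

(* Only meaningful when the limit exists. *)
Definition threshold_density (R : realType) (k : nat) (p : R) : R :=
  lim (median_threshold k p n @[n --> \oo]).

Definition classical_threshold_density (R : realType) (k : nat) : R :=
  threshold_density k (2^-1 : R).

Lemma card_distinct_tuple (n k : nat) : #|distinct_tuple n k| = (n ^_ k)%N.
Proof.
rewrite card_sig -[in RHS](card_ord n) -[in RHS](card_ord k) -card_inj_ffuns.
by apply: eq_card => f; rewrite !inE.
Qed.

Lemma formula_prob_total (R : realType) (n k : nat) (p : R) (m : nat) :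
  (k <= n)%N -> formula_prob p (fun _ : formula n k m => true) = 1.
Proof.
move=> kn; rewrite /formula_prob.
rewrite -(bigA_distr_bigA (fun _ : 'I_m => @draw_prob R n k p)).
rewrite big1// => _ _.
pose T := distinct_tuple n k.
pose F (P : {ffun 'I_k -> bool}) : R := \prod_(j < k) (if P j then p else 1 - p).
have FE : \sum_P F P = 1.
  rewrite -(bigA_distr_bigA (fun (_ : 'I_k) (b : bool) => if b then p else 1 - p)).
  by rewrite big1// => _ _; rewrite big_bool/= addrC subrK.
transitivity (\sum_(d : T * bool) \sum_P #|T|%:R^-1 * 2^-1 * F P).
  by rewrite pair_bigA; apply: eq_bigr => -[[K B] P] _.
under eq_bigr do rewrite -mulr_sumr FE mulr1.
rewrite sumr_const card_prod card_bool -[LHS]mulr_natl natrM mulrACA.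
have T0 : #|T|%:R != 0 :> R.
  by rewrite pnatr_eq0 card_distinct_tuple -lt0n ffact_gt0.
by rewrite divff// divff ?mulr1// pnatr_eq0.
Qed.

Lemma median_threshold_min (R : realType) (k : nat) (p : R) (n : nat) :
  (exists m, sat_prob n k p m <= 2^-1) ->
  exists m, [/\ sat_prob n k p m <= 2^-1,
    forall m', sat_prob n k p m' <= 2^-1 -> (m <= m')%N &
    median_threshold k p n = m%:R / n%:R].
Proof.
move=> ex; case: (ex_minnP ex) => m Pm mmin; exists m; split=> //.
rewrite /median_threshold; set S := (X in inf X).
have lbm : lbound S (m%:R / n%:R).
  by move=> _ [m' /= Pm' <-]; rewrite ler_wpM2r ?invr_ge0// ler_nat mmin.
apply/eqP; rewrite eq_le; apply/andP; split.
  by apply: ge_inf; [exists (m%:R / n%:R) | exists m].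
by apply: lb_le_inf => //; exists (m%:R / n%:R), m.
Qed.

(* Main.v *)
Require Import Defs.
From HB Require Import structures.
From mathcomp Require Import all_boot all_order all_algebra.
From mathcomp Require Import all_classical all_reals all_analysis.
From mathcomp Require Import ring lra zify.

Set Implicit Arguments.
Unset Strict Implicit.
Unset Printing Implicit Defensive.

Import Order.TTheory GRing.Theory Num.Theory.
Import numFieldNormedType.Exports.

(* Below the threshold: an unsatisfiable 2-CNF contains a bicycle, i.e. a path
   u -> w_1 -> ... -> w_s -> v of implications whose literals w_i have distinct
   variables, with ~u among the w_i and the variable of v among theirs.  Given a
   literal l and a variable y, a random clause gives an implication from l to
   one of y, ~y with probability 1/(n(n-1)) for every polarization, so that the
   expected number of bicycles is at most 32 n^2 / (n - m)^3.

   Above the threshold: a depth-first search on the implications given by the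
   first n + 9n/j clauses, j of order n^(1/10), finds a path of about n/j^3
   implications between literals with distinct variables (the argument of
   Krivelevich and Sudakov for long paths in sparse random graphs).  Each
   variable pair is queried once, and as above the polarization plays no role.
   Two more clauses make the formula unsatisfiable: one whose literals lie in
   the first half of the path, and one whose negated literals lie in the second
   half.  The next n/j clauses contain both with high probability. *)

(** The probability of an implication between two given literals does depend on [p]. What is free of
    [p] is a sum over one sign: the fair [B] makes each literal of a clause unbiased on its own. So
    the bicycle count sums over the signs along the path, and the search asks for a variable and
    accepts either of its literals. For the closing clauses no such sum is available, and a lower
    bound on equal signs replaces it. The number of clauses is fixed, so the answers to successive
    queries are dependent. Instead of coupling them with independent trials, the proof bounds the
    failure probability by a weight on states that no query increases in total. Scales: put
    [u = 1/j]. A search stopped after about [n u^2] variables tolerates a clause excess of order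
    [u n] and yields a path of order [n u^3]. Among [n/j] further clauses, the expected number with
    both literals in a prescribed set of that order is of order [(n/j) (n/j^3)^2 / n^2 = n/j^7]; it
    is at least of order [j] once [j^8 <= n], which makes the failure probability [O(1/j)]. Below
    the threshold, [n^2 / (n - m)^3] vanishes exactly when [n - m] dominates [n^(2/3)]. *)

(* [literal n] unfolded, so that its [finType] structure is found. *)
Notation lit n := ('I_n * bool)%type.

Definition neg (n : nat) (l : lit n) : lit n := (l.1, ~~ l.2).

Lemma negK (n : nat) : involutive (@neg n).
Proof. by case=> v s; rewrite /neg /= negbK. Qed.

(** * Implication graphs of 2-CNF formulas *)

Lemma uniq_map_inj (S T : eqType) (f : S -> T) (s : seq S) :
  uniq (map f s) -> {in s &, injective f}.
Proof.
elim: s => [//|c s IH] /= /andP[cs us] a b; rewrite !inE.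
case/orP=> [/eqP ->|as_] /orP[/eqP ->|bs] //; last exact: IH.
  by move=> fcb; rewrite fcb map_f in cs.
by move=> fac; rewrite -fac map_f in cs.
Qed.

Section ImplicationGraph.
Context (n : nat) (e : rel (lit n)).
Context (e_contra : forall l l', e l l' -> e (neg l') (neg l)).

Definition holds (x : {ffun 'I_n -> bool}) (l : lit n) : bool := x l.1 == l.2.

Lemma holds_neg (x : {ffun 'I_n -> bool}) (l : lit n) :
  holds x (neg l) = ~~ holds x l.
Proof. by rewrite /holds /neg /=; case: (x _); case: (l.2). Qed.

Lemma connect_contra (l l' : lit n) :
  connect e l l' -> connect e (neg l') (neg l).
Proof.
case/connectP=> q; elim: q l => [|a q IH] l /= => [_ ->|/andP[la ha] el].
  exact: connect0.
by apply: (connect_trans (IH _ ha el)); apply/connect1/e_contra.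
Qed.

Lemma neg_neq (l : lit n) : neg l != l.
Proof. by case: l => v []; apply/eqP => -[]. Qed.

Lemma same_var (l l' : lit n) : l.1 = l'.1 -> l' = l \/ l' = neg l.
Proof.
case: l l' => v s [v' s'] /= <-; rewrite /neg /=.
by case: s; case: s'; [left|right|right|left].
Qed.

(** Take a maximal set [T] of literals that is closed under implication and free of complementary
    pairs. If it missed both [l] and [neg l], everything reachable from one of them could be added:
    a conflict would turn, by contraposition, into a path to the negation of the added literal. So
    [T] is a full assignment. *)
Lemma exists_model :
  (forall l, ~~ (connect e l (neg l) && connect e (neg l) l)) ->
  exists x, forall l l', e l l' -> holds x l -> holds x l'.
Proof.
move=> nocycle.
pose P (T : {set lit n}) := [forall l in T, neg l \notin T] &&
  [forall l in T, forall l', e l l' ==> (l' \in T)].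
have P0 : P finset.set0 by apply/andP; split; apply/forall_inP => l; rewrite inE.
have [T /maxsetP[/andP[/forall_inP cons /forall_inP clos] Tmax] _] := maxset_exists P0.
have closP l l' : l \in T -> connect e l l' -> l' \in T.
  move=> lT /connectP[q]; elim: q l lT => [|a q IH] l lT /= => [_ -> //|/andP[la ha] el].
  by apply: IH ha el; have /forallP/(_ a)/implyP := clos _ lT; apply.
have total l : (l \in T) || (neg l \in T).
  (* By [nocycle], one of [l], [neg l] has no path to its negation, and the claim is symmetric in
     the two. *)
  wlog ncl : l / ~~ connect e l (neg l).
    move=> W; have := nocycle l; rewrite negb_and => /orP[/W//|h].
    by have := W (neg l); rewrite negK orbC; apply.
  case: (boolP (neg l \in T)) => [|nlT]; first by rewrite orbT.
  rewrite orbF.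
  suff /Tmax <- : P (T :|: [set l' | connect e l l']); first by rewrite !inE connect0 orbT.
    exact: finset.subsetUl.
  apply/andP; split; apply/forall_inP => a; rewrite !inE.
    move=> h; rewrite negb_or; case/orP: h => [aT|la].
      rewrite cons //=; apply: contra nlT => /connect_contra; rewrite negK.
      exact: closP.
    apply/andP; split.
      apply: contra nlT => /closP; apply.
      exact: connect_contra.
    apply: contra ncl => la'; apply: (connect_trans la).
    by have := connect_contra la'; rewrite negK.
  move=> h; apply/forallP => b; apply/implyP => ab; rewrite !inE.
  case/orP: h => [aT|la]; first by rewrite (closP _ _ aT) // connect1.
  by rewrite (connect_trans la) ?orbT // connect1.
exists [ffun v => (v, true) \in T] => l l' ll'.
have TE a : holds [ffun v => (v, true) \in T] a = (a \in T).
  rewrite /holds ffunE; case: a => v [] /=; first by rewrite eqb_id.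
  apply/idP/idP => [/eqP h|]; first by have := total (v, true); rewrite h.
  by move=> h; have := cons _ h; rewrite /neg /= => /negPf ->.
by rewrite !TE => lT; apply: closP lT _; apply: connect1.
Qed.

(* A path from [y] to [~y] of minimal length has no repeated variable, and it
   then extends along a path back to [y] up to the first repetition. *)
Lemma bicycle (x : lit n) : connect e x (neg x) -> connect e (neg x) x ->
  exists u w v, [/\ path e u (rcons w v), uniq (map fst w), neg u \in w &
    v.1 \in map fst w].
Proof.
move=> cx cx'.
pose Q k := [exists y, connect e (neg y) y && [exists q : k.-tuple (lit n),
   path e y q && (last y q == neg y)]].
have exQ : exists k, Q k.
  case/connectP: cx => q hq lq; exists (size q); apply/existsP; exists x.
  by rewrite cx' /=; apply/existsP; exists (in_tuple q); rewrite /= hq lq /=.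
have [y [q [cy pq lq kmin]]] : exists (y : lit n) (q : seq (lit n)),
    [/\ connect e (neg y) y, path e y q, last y q = neg y &
      forall (z : lit n) (s : seq (lit n)), connect e (neg z) z ->
        path e z s -> last z s = neg z -> size q <= size s].
  have [k /existsP[y /andP[cy /existsP[q /andP[pq /eqP lq]]]] kmin] := ex_minnP exQ.
  exists y, q; split=> // z s cz pz lz; rewrite size_tuple.
  apply: kmin; apply/existsP; exists z.
  by rewrite cz /=; apply/existsP; exists (in_tuple s); rewrite /= pz lz /=.
(* Suppose positions [i < j] carry the same variable. If the literals agree, cutting out the loop
   shortens [q]. If they are opposite, the segment between them is a shorter path from a literal to
   its negation, and the way back goes through [neg y], then [y]. *)
have uq : uniq (map fst q).
  apply: contraT => /(uniqPn y.1)[i [j [ij]]]; rewrite size_map => jq.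
  rewrite !(nth_map y) ?(ltn_trans ij) // => eij.
  have iq : i < size q by apply: ltn_trans jq.
  have p1 : path e y (take i.+1 q) by rewrite take_path.
  have l1 : last y (take i.+1 q) = nth y q i.
    by rewrite (take_nth y) // last_rcons.
  have p3 : path e (nth y q j) (drop j.+1 q).
    have := pq; rewrite -{1}(cat_take_drop j.+1 q) cat_path (take_nth y) //.
    by rewrite last_rcons => /andP[].
  have l3 : last (nth y q j) (drop j.+1 q) = neg y.
    rewrite -lq -[in RHS](cat_take_drop j.+1 q) last_cat (take_nth y) //.
    by rewrite last_rcons.
  have cyi : connect e y (nth y q i).
    by apply/connectP; exists (take i.+1 q).
  have cjy : connect e (nth y q j) (neg y).
    by apply/connectP; exists (drop j.+1 q).
  case: (same_var eij) => eqij.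
    have := kmin y (take i.+1 q ++ drop j.+1 q) cy.
    rewrite cat_path p1 l1 last_cat l1 -eqij p3 l3 => /(_ isT erefl).
    by rewrite size_cat size_takel // size_drop; move: (size q) ij jq; clear; lia.
  pose s := drop i.+1 (take j.+1 q).
  have := kmin (nth y q i) s.
  have sE : size s = j - i by rewrite size_drop size_takel //; lia.
  have dE : take i.+1 q ++ s = take j.+1 q.
    by rewrite -[RHS](cat_take_drop i.+1) take_takel // ltnW.
  have ps : path e y (take j.+1 q) by rewrite take_path.
  have ls : last y (take j.+1 q) = nth y q j by rewrite (take_nth y) // last_rcons.
  move: ps ls; rewrite -dE cat_path last_cat l1 p1 /= => ps ls.
  rewrite ps ls eqij sE => h; suff : size q <= j - i.
    by rewrite leqNgt (leq_ltn_trans (leq_subr _ _)).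
  apply: h => //.
  by rewrite -eqij; apply: (connect_trans cjy (connect_trans cy cyi)).
have yq : neg y \in q.
  by case: q lq {pq kmin uq} => [/esym/eqP|a q <-]; rewrite ?(negPf (neg_neq y)) //= mem_last.
case/connectP: cy => r.
rewrite -lq.
have : path e y q := pq.
have : neg y \in q := yq.
have : uniq (map fst q) := uq.
have : y.1 \in map fst q by apply/mapP; exists (neg y).
have : q != [::] by case: (q) yq.
(* The literals of the return path are appended while their variables are new. A repetition must
   occur: otherwise [s] would end with both [y] and [neg y] in it, against the distinctness of its
   variables. *)
elim: r (q) => [|b r IH] s s0 ys us nys ps /=.
  move=> _ yl; have ys' : y \in s by rewrite yl; case: (s) s0 => //= a t _; exact: mem_last.
  by have /eqP := uniq_map_inj us nys ys' erefl; rewrite (negPf (neg_neq y)).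
move=> /andP[sb rb] yl.
case: (boolP (b.1 \in map fst s)) => bs.
  by exists y, s, b; rewrite rcons_path ps.
apply: (IH (rcons s b)); rewrite ?last_rcons //.
- by case: (s).
- by rewrite map_rcons mem_rcons inE ys orbT.
- by rewrite map_rcons rcons_uniq bs.
- by rewrite mem_rcons inE nys orbT.
- by rewrite rcons_path ps.
Qed.
End ImplicationGraph.

Local Open Scope ring_scope.

(** * Independent draws *)

Section ProductProbability.
Context (R : realFieldType) (D : finType) (mu : D -> R).

Definition mass (G : pred D) : R := \sum_(d | G d) mu d.

Definition Pr (m : nat) (E : pred {ffun 'I_m -> D}) : R :=
  \sum_(w | E w) \prod_i mu (w i).

Lemma Pr_rect (m : nat) (G : 'I_m -> pred D) :
  Pr (fun w => [forall i, G i (w i)]) = \prod_i mass (G i).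
Proof.
rewrite /mass (bigA_distr_big_dep (fun i d => G i d) (fun _ d => mu d)).
by apply: eq_bigl => w; apply/forallP/familyP.
Qed.

Context (mu_ge0 : forall d, 0 <= mu d).

Lemma mass_ge0 (G : pred D) : 0 <= mass G.
Proof. exact: sumr_ge0. Qed.

Lemma mass_le (G H : pred D) : (forall d, G d -> H d) -> mass G <= mass H.
Proof.
move=> GH; rewrite /mass [leRHS](bigID G) /= ler_wpDr ?sumr_ge0 //.
rewrite (eq_bigl (fun d => H d && G d)) // => d.
by case: (boolP (G d)) => [/GH ->|]; rewrite ?andbF.
Qed.

Lemma mass_orP (G H : pred D) :
  mass (fun d => G d || H d) <= mass G + mass H.
Proof.
rewrite /mass (bigID G) /=; apply: lerD.
  apply: (@mass_le (fun d => (G d || H d) && G d) G) => d /andP[_ h]; exact: h.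
by apply: (@mass_le (fun d => (G d || H d) && ~~ G d) H) => d /andP[]; case: (G d).
Qed.

Lemma mass_or (G H : pred D) : (forall d, G d -> ~~ H d) ->
  mass (fun d => G d || H d) = mass G + mass H.
Proof.
move=> GH; rewrite /mass (bigID G) /=; congr (_ + _).
  by apply: eq_bigl => d; case: (G d); rewrite ?andbF.
by apply: eq_bigl => d; case: (boolP (G d)) => [/GH/negPf ->|]; rewrite /= ?andbT.
Qed.

Lemma massC (G : pred D) : mass predT = 1 -> mass (fun d => ~~ G d) = 1 - mass G.
Proof. by move=> <-; rewrite /mass [X in _ = X - _](bigID G) /= addrAC subrr add0r. Qed.

Lemma wt_ge0 (m : nat) (w : {ffun 'I_m -> D}) : 0 <= \prod_i mu (w i).
Proof. by apply: prodr_ge0 => i _. Qed.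

Lemma Pr_ge0 (m : nat) (E : pred {ffun 'I_m -> D}) : 0 <= Pr E.
Proof. by apply: sumr_ge0 => w _; exact: wt_ge0. Qed.

Lemma Pr_le (m : nat) (E F : pred {ffun 'I_m -> D}) :
  (forall w, E w -> F w) -> Pr E <= Pr F.
Proof.
move=> EF; rewrite /Pr [leRHS](bigID E) /= ler_wpDr //.
  by apply: sumr_ge0 => w _; exact: wt_ge0.
rewrite (eq_bigl (fun w => F w && E w)) // => w.
by case: (boolP (E w)) => [/EF ->|]; rewrite ?andbF.
Qed.

Lemma Pr_union (m : nat) (I : Type) (r : seq I) (P : pred I)
    (E : pred {ffun 'I_m -> D}) (F : I -> pred {ffun 'I_m -> D}) :
  (forall w, E w -> has (fun i => P i && F i w) r) ->
  Pr E <= \sum_(i <- r | P i) Pr (F i).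
Proof.
elim: r E => [|a r IH] E EF.
  by rewrite big_nil /Pr big_pred0 // => w; apply/negP => /EF.
have IH' : Pr (fun w => E w && ~~ (P a && F a w)) <= \sum_(i <- r | P i) Pr (F i).
  by apply: IH => w /andP[/EF /= /orP[->|//]].
rewrite big_cons.
have -> : Pr E = Pr (fun w => E w && (P a && F a w)) +
    Pr (fun w => E w && ~~ (P a && F a w)).
  by rewrite /Pr (bigID (fun w => P a && F a w)).
case: (P a) IH' => /= IH'.
  by apply: lerD => //; apply: Pr_le => w /andP[].
rewrite [X in X + _](_ : _ = 0) ?add0r; last by rewrite /Pr big_pred0 // => w; rewrite andbF.
by apply: le_trans IH'; apply: Pr_le => w; rewrite andbT.
Qed.

Lemma Pr_or (m : nat) (E F G : pred {ffun 'I_m -> D}) :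
  (forall w, E w -> F w || G w) -> Pr E <= Pr F + Pr G.
Proof.
move=> EFG; have := @Pr_union m bool [:: true; false] predT E
  (fun b w => if b then F w else G w).
rewrite !big_cons big_nil addr0 /=; apply => w /EFG.
by rewrite orbF.
Qed.

Context (mu1 : mass predT = 1).

Lemma mass_le1 (G : pred D) : mass G <= 1.
Proof. by rewrite -mu1; exact: mass_le. Qed.

Lemma Pr_total (m : nat) : Pr (fun _ : {ffun 'I_m -> D} => true) = 1.
Proof.
transitivity (Pr (fun w : {ffun 'I_m -> D} => [forall i, predT (w i)])).
  by apply: eq_bigl => w; apply/esym/forallP.
by rewrite (Pr_rect (fun=> predT)) big1.
Qed.

Lemma PrC (m : nat) (E : pred {ffun 'I_m -> D}) :
  Pr (fun w => ~~ E w) = 1 - Pr E.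
Proof.
by rewrite -(Pr_total m) /Pr [X in _ = X - _](bigID E) /= addrAC subrr add0r.
Qed.

Definition fstf m1 m2 (w : {ffun 'I_(m1 + m2) -> D}) : {ffun 'I_m1 -> D} :=
  [ffun i => w (lshift m2 i)].
Definition sndf m1 m2 (w : {ffun 'I_(m1 + m2) -> D}) : {ffun 'I_m2 -> D} :=
  [ffun i => w (rshift m1 i)].
Definition catf m1 m2 (uv : {ffun 'I_m1 -> D} * {ffun 'I_m2 -> D}) :
    {ffun 'I_(m1 + m2) -> D} :=
  [ffun i => match fintype.split i with inl j => uv.1 j | inr j => uv.2 j end].

Lemma fst_catf m1 m2 (uv : {ffun 'I_m1 -> D} * {ffun 'I_m2 -> D}) :
  fstf (catf uv) = uv.1.
Proof.
apply/ffunP => i; rewrite !ffunE.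
case: splitP => j /= e; first by congr (_ _); apply: val_inj.
by move: (ltn_ord i); rewrite e ltnNge leq_addr.
Qed.

Lemma snd_catf m1 m2 (uv : {ffun 'I_m1 -> D} * {ffun 'I_m2 -> D}) :
  sndf (catf uv) = uv.2.
Proof.
apply/ffunP => i; rewrite !ffunE.
case: splitP => j /= e; first by move: (ltn_ord j); rewrite -e ltnNge leq_addr.
by congr (_ _); apply: val_inj; apply/eqP; rewrite -(eqn_add2l m1) e.
Qed.

Lemma catf_fs m1 m2 (w : {ffun 'I_(m1 + m2) -> D}) : catf (fstf w, sndf w) = w.
Proof.
apply/ffunP => i; rewrite !ffunE.
by case: splitP => j /= e; rewrite ffunE; congr (_ _); apply: val_inj.
Qed.

Lemma sum_catf m1 m2 (F : {ffun 'I_(m1 + m2) -> D} -> R) :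
  \sum_w F w * \prod_i mu (w i) =
  \sum_(u : {ffun 'I_m1 -> D}) \sum_(v : {ffun 'I_m2 -> D})
    F (catf (u, v)) * (\prod_i mu (u i) * \prod_i mu (v i)).
Proof.
rewrite pair_bigA /= (reindex (@catf m1 m2)) /=; last first.
  exists (fun w => (fstf w, sndf w)) => w _; last exact: catf_fs.
  by rewrite fst_catf snd_catf; case: w.
apply: eq_bigr => -[u v] _ /=; congr (_ * _).
rewrite big_split_ord /=; congr (_ * _); apply: eq_bigr => i _.
  by have /ffunP/(_ i) := fst_catf (u, v); rewrite ffunE => ->.
by have /ffunP/(_ i) := snd_catf (u, v); rewrite ffunE => ->.
Qed.

Lemma Pr_indic (m : nat) (E : pred {ffun 'I_m -> D}) :
  Pr E = \sum_w (E w)%:R * \prod_i mu (w i).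
Proof.
rewrite /Pr big_mkcond; apply: eq_bigr => w _.
by case: (E w); rewrite ?mul1r ?mul0r.
Qed.

Lemma Pr_fst m1 m2 (E : pred {ffun 'I_m1 -> D}) :
  Pr (fun w : {ffun 'I_(m1 + m2) -> D} => E (fstf w)) = Pr E.
Proof.
rewrite !Pr_indic sum_catf; apply: eq_bigr => u _.
under [LHS]eq_bigr => v _ do rewrite (fst_catf (u, v)) /= mulrA.
rewrite -mulr_sumr.
transitivity ((E u)%:R * \prod_i mu (u i) * Pr (fun _ : {ffun 'I_m2 -> D} => true)).
  by congr (_ * _); rewrite Pr_indic; under [RHS]eq_bigr do rewrite mul1r.
by rewrite Pr_total mulr1.
Qed.

Lemma Pr_cond m1 m2 (E : pred {ffun 'I_(m1 + m2) -> D}) (b : R) :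
  (forall u, Pr (fun v => E (catf (u, v))) <= b) -> Pr E <= b.
Proof.
move=> Eb; rewrite Pr_indic sum_catf.
apply: (@le_trans _ _ (\sum_(u : {ffun 'I_m1 -> D}) \prod_i mu (u i) * b)).
  apply: ler_sum => u _.
  under [leLHS]eq_bigr do rewrite mulrCA.
  rewrite -mulr_sumr ler_wpM2l ?wt_ge0 //.
  by rewrite -Pr_indic.
rewrite -mulr_suml; have := Pr_total m1; rewrite /Pr => ->; by rewrite mul1r.
Qed.

Lemma Pr_slots (k m : nat) (H : 'I_k -> pred D) (f : 'I_k -> 'I_m) :
  injective f ->
  Pr (fun w : {ffun 'I_m -> D} => [forall a, H a (w (f a))]) <=
  \prod_a mass (H a).
Proof.
move=> finj.
pose G i := [pred d | [forall a, (f a == i) ==> H a d]].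
apply: (@le_trans _ _ (\prod_i mass (G i))).
  rewrite -Pr_rect; apply: Pr_le => w /forallP Hw.
  by apply/forallP => i; apply/forallP => a; apply/implyP => /eqP <-.
rewrite (bigID [in f @: 'I_k]) /= big_imset /=; last by move=> a b _ _ /finj.
rewrite -[leRHS]mulr1; apply: ler_pM; try by apply: prodr_ge0 => *; exact: mass_ge0.
  apply: ler_prod => a _; rewrite mass_ge0 /=; apply: mass_le => d.
  by move=> /forallP/(_ a); rewrite eqxx.
by apply: prodr_ile1 => i _; rewrite mass_ge0 mass_le1.
Qed.

(** One draw cannot satisfy two of the [H a], so the witnessing slots form an injection; a union
    bound runs over the at most [m ^ k] injections. *)
Lemma Pr_distinct_slots (k m : nat) (H : 'I_k -> pred D) :
  (forall a b d, a != b -> H a d -> ~~ H b d) ->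
  Pr (fun w : {ffun 'I_m -> D} => [forall a, [exists i, H a (w i)]]) <=
  m%:R ^+ k * \prod_a mass (H a).
Proof.
move=> disj.
pose F (f : {ffun 'I_k -> 'I_m}) (w : {ffun 'I_m -> D}) :=
  [forall a, H a (w (f a))].
apply: (@le_trans _ _ (\sum_(f : {ffun 'I_k -> 'I_m} | injectiveb f) Pr (F f))).
  apply: Pr_union => w /forallP Hw; apply/hasP.
  pose f := [ffun a => xchoose (existsP (Hw a))].
  have fP a : H a (w (f a)) by rewrite ffunE; exact: (xchooseP (existsP (Hw a))).
  exists f; first exact: mem_index_enum.
  apply/andP; split; last exact/forallP.
  apply/injectiveP => a b fab; apply: contraTeq (fP b) => ab.
  by rewrite -fab; apply: disj (fP a).
apply: (@le_trans _ _ (\sum_(f : {ffun 'I_k -> 'I_m} | injectiveb f) \prod_a mass (H a))).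
  by apply: ler_sum => f /injectiveP; exact: Pr_slots.
rewrite sumr_const -[leLHS]mulr_natl ler_wpM2r ?prodr_ge0 // => [a _|].
  exact: mass_ge0.
rewrite -natrX ler_nat -[X in (_ <= X ^ _)%N]card_ord -[X in (_ <= _ ^ X)%N]card_ord.
by rewrite -card_ffun max_card.
Qed.

End ProductProbability.

(** * The distribution of one clause *)

Definition clause_pair (n : nat) (d : clause_draw n 2) : lit n * lit n :=
  (clause_of d ord0, clause_of d ord_max).

(* [d] draws the clause [~l \/ l'], that is, the implication from [l] to [l']. *)
Definition hit (n : nat) (l l' : lit n) (d : clause_draw n 2) : bool :=
  (clause_pair d == (neg l, l')) || (clause_pair d == (l', neg l)).

Section DrawMass.
Context (R : realType) (n : nat) (p : R).

(* The probability that a clause gives an implication from a fixed literal to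
   one of the two literals on another fixed variable. *)
Definition edge_prob : R := (n * n.-1)%:R^-1.
(** The probability that the two signs of a clause form one given pattern, averaged over [B]; it
    depends only on whether the two signs agree ([true]) or differ ([false]). *)
Definition sgn_prob (b : bool) : R :=
  if b then (p ^+ 2 + (1 - p) ^+ 2) / 2 else p * (1 - p).

(** The source of independence from [p]: with one sign fixed and the other free, only the fair
    marginal of the fixed sign remains. *)
Lemma sgn_prob_sum : sgn_prob true + sgn_prob false = 2^-1.
Proof. by rewrite /sgn_prob; field. Qed.

(** The ordered literals fix the tuple of variables, and each value of [B] then determines all the
    [P_j]. Exactly two draws contribute, one for each [B], or none if the variables coincide. *)
Lemma mass_atom (a b : lit n) :
  mass (@draw_prob R n 2 p) (fun d => clause_pair d == (a, b)) =
  if a.1 == b.1 then 0 else edge_prob * sgn_prob (a.2 == b.2).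
Proof.
rewrite /mass.
have ord2 (j : 'I_2) : j = ord0 \/ j = ord_max.
  by case: j => -[|[|//]] h; [left|right]; apply: val_inj.
case: ifPn => [/eqP ab|ab].
  apply: big_pred0 => -[[K B] P]; apply/negP => /eqP[].
  rewrite !ffunE => e1 e2; rewrite -e1 -e2 /= in ab.
  by move/injectiveP: (valP K) => /(_ _ _ ab).
have inj0 : injectiveb [ffun j : 'I_2 => if j == ord0 then a.1 else b.1].
  apply/injectiveP => i j; rewrite !ffunE.
  case: (ord2 i) (ord2 j) => -> [] -> //= e; first by rewrite e eqxx in ab.
  by rewrite e eqxx in ab.
pose K0 : distinct_tuple n 2 := exist (fun K : {ffun _} => is_true (injectiveb K)) _ inj0.
pose PB (B : bool) : {ffun 'I_2 -> bool} :=
  [ffun j => B == (if j == ord0 then a.2 else b.2)].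
have condE d : (clause_pair d == (a, b)) = (d == (K0, d.1.2, PB d.1.2)).
  case: d => -[K B] P /=; apply/eqP/eqP.
    rewrite /clause_pair !ffunE => -[] e1 e2.
    congr (_, _, _).
      apply: val_inj; apply/ffunP => j; rewrite !ffunE -e1 -e2 /=.
      by case: (ord2 j) => ->.
    apply/ffunP => j; rewrite !ffunE -e1 -e2 /=.
    by case: (ord2 j) => -> /=; case: (B); case: (P _).
  rewrite /clause_pair => -[-> ->]; rewrite !ffunE /=.
  by case: a b B {ab inj0 K0 PB} => [a1 a2] [b1 b2] []; case: a2; case: b2.
rewrite (eq_bigl _ _ condE) (reindex_onto (fun B => (K0, B, PB B)) (fun d => d.1.2)) /=; last first.
  by move=> d /eqP.
rewrite (eq_bigl predT); last by move=> B; rewrite /= !eqxx.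
rewrite big_bool /= !big_ord_recl !big_ord0 !ffunE /= mulr1.
rewrite card_distinct_tuple /edge_prob ffactnS ffactn1 /sgn_prob.
set h := (_%:R)^-1.
by case: (a.2); case: (b.2) => /=; field.
Qed.

Lemma draw_mass_total : (1 < n)%N -> mass (@draw_prob R n 2 p) predT = 1.
Proof.
move=> n1; rewrite -[RHS](@formula_prob_total R n 2 p 1 n1) /formula_prob.
transitivity (\prod_(i < 1) mass (@draw_prob R n 2 p) predT).
  by rewrite big_ord_recl big_ord0 mulr1.
rewrite -(Pr_rect (draw_prob p) (fun=> predT)) /Pr.
by apply: eq_bigl => w; apply/forallP.
Qed.

Lemma edge_prob_le1 : (1 < n)%N -> edge_prob <= 1.
Proof.
move=> n1; have n0 : (0 < n * n.-1)%N by rewrite muln_gt0 -subn1 subn_gt0 n1 ltnW.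
by rewrite invf_le1 ?ler1n // ltr0n.
Qed.

Context (p_ge0 : 0 <= p) (p_le1 : p <= 1).

Lemma draw_prob_ge0 (d : clause_draw n 2) : 0 <= draw_prob p d.
Proof.
case: d => -[K B] P /=; rewrite !mulr_ge0 ?invr_ge0 // prodr_ge0 // => j _.
by case: ifP; rewrite // subr_ge0.
Qed.

Lemma edge_probE : edge_prob = (n%:R * n.-1%:R)^-1.
Proof. by rewrite -natrM. Qed.

Lemma edge_prob_ge0 : 0 <= edge_prob.
Proof. by rewrite invr_ge0. Qed.

Lemma sgn_prob_same_ge : 4^-1 <= sgn_prob true.
Proof. by rewrite /sgn_prob; have := sqr_ge0 (p - 2^-1); lra. Qed.

Definition hit_mass (l l' : lit n) : R := mass (@draw_prob R n 2 p) (hit l l').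

Lemma hit_mass_ge0 (l l' : lit n) : 0 <= hit_mass l l'.
Proof. by apply: mass_ge0; exact: draw_prob_ge0. Qed.

Lemma hit_massE (l l' : lit n) :
  hit_mass l l' = if l.1 == l'.1 then 0
                  else edge_prob * (sgn_prob (~~ l.2 == l'.2) * 2).
Proof.
case: ifPn => ll'.
  apply/eqP; rewrite eq_le hit_mass_ge0 andbT.
  apply: le_trans (mass_orP draw_prob_ge0 _ _) _.
  by rewrite !mass_atom /= ll' eq_sym ll' addr0.
rewrite /hit_mass mass_or; last first.
  move=> d /eqP ->; apply/eqP => -[] e _; move: ll'; rewrite -e eqxx //.
rewrite !mass_atom /= [l'.1 == _]eq_sym (negPf ll') [l'.2 == _]eq_sym.
by rewrite mulr2n mulrDr mulr1 mulrDr.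
Qed.

Lemma hit_mass_sum (l : lit n) (y : 'I_n) : l.1 != y ->
  hit_mass l (y, true) + hit_mass l (y, false) = edge_prob.
Proof.
move=> ly; rewrite !hit_massE /= (negPf ly) -mulrDr -mulrDl.
have -> : sgn_prob (~~ l.2 == true) + sgn_prob (~~ l.2 == false) = 2^-1.
  by rewrite -sgn_prob_sum; case: (l.2); rewrite /= // addrC.
by rewrite mulVf ?mulr1.
Qed.

Lemma hit_mass_le (l l' : lit n) : hit_mass l l' <= edge_prob.
Proof.
case: (eqVneq l.1 l'.1) => [e|ne]; first by rewrite hit_massE e eqxx edge_prob_ge0.
rewrite -(hit_mass_sum ne); case: l' {ne} => y [].
  by rewrite lerDl hit_mass_ge0.
by rewrite lerDr hit_mass_ge0.
Qed.

(** With [m] clauses a literal thus has at most [m / n] successors on average, for every [p]: the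
    implication graph is subcritical when [m < n]. *)
Lemma hit_mass_row (l : lit n) : \sum_l' hit_mass l l' <= n%:R^-1.
Proof.
rewrite -(pair_bigA _ (fun y s => hit_mass l (y, s))) /= (bigD1 l.1) //=.
rewrite big_bool /= !hit_massE /= eqxx !addr0 add0r.
rewrite (eq_bigr (fun=> edge_prob)) => [|y ly]; last first.
  by rewrite big_bool /= hit_mass_sum // eq_sym.
rewrite sumr_const cardC1 card_ord /edge_prob natrM.
have [-> |n1] := posnP n.-1; first by rewrite mulr0n invr_ge0.
by rewrite invfM -mulrnAr -[X in _ * X <= _]mulr_natr mulVf ?mulr1 // pnatr_eq0 -lt0n.
Qed.

(* Only the clauses with two equal signs are counted: they have total
   probability at least 1/2 for every polarization. *)
Lemma mass_same_sign (S : {set lit n}) :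
  {in S &, forall a b : lit n, a.2 = b.2} ->
  (#|S| * #|S|.-1)%:R * (edge_prob / 4) <=
  mass (@draw_prob R n 2 p)
    (fun d => ((clause_pair d).1 \in S) && ((clause_pair d).2 \in S)).
Proof.
move=> sS; rewrite /mass (partition_big (@clause_pair n)
  (fun q : lit n * lit n => (q.1 \in S) && (q.2 \in S))) //=.
rewrite (eq_bigr (fun q : lit n * lit n =>
  if q.1.1 == q.2.1 then 0 else edge_prob * sgn_prob (q.1.2 == q.2.2))); last first.
  move=> [a b] /andP[/= aS bS]; rewrite -mass_atom; apply: eq_bigl => d.
  by apply: andb_idl; rewrite /clause_pair => /eqP[-> ->]; rewrite aS.
rewrite -(pair_big (mem S) (mem S) (fun a b : lit n =>
  if a.1 == b.1 then 0 else edge_prob * sgn_prob (a.2 == b.2))) /=.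
apply: (@le_trans _ _ (\sum_(a in S) (edge_prob / 4) *+ #|S|.-1)).
  rewrite sumr_const -mulrnA -[leRHS]mulr_natl; by rewrite mulnC.
apply: ler_sum => a aS; rewrite (bigD1 a) //= eqxx add0r.
rewrite (eq_bigr (fun=> edge_prob * sgn_prob true)); last first.
  move=> b /andP[bS ba]; rewrite (sS _ _ aS bS) eqxx ifN //.
  apply: contraNN ba => /eqP e; apply/eqP.
  by rewrite [b]surjective_pairing -e -(sS _ _ aS bS) -surjective_pairing.
rewrite sumr_const.
have -> : #|(fun b => (b \in S) && (b != a))| = #|S|.-1.
  by rewrite (cardD1 a) aS /=; apply: eq_card => b; rewrite !inE andbC.
by rewrite lerMn2r ler_wpM2l ?orbT ?edge_prob_ge0 ?sgn_prob_same_ge.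
Qed.

End DrawMass.

(** * The first moment of bicycles *)

Lemma sum_sqr_geometric_le (R : realFieldType) (r : R) (N : nat) :
  0 <= r -> r <= 1 -> (1 - r) ^+ 3 * (\sum_(s < N) s.+1%:R ^+ 2 * r ^+ s) <= 2.
Proof.
move=> r0 r1.
(* For [r < 1] the whole series is [(1 + r) / (1 - r) ^+ 3]; the subtracted term is the exact
   contribution of the tail, and it is nonnegative. *)
have -> : (1 - r) ^+ 3 * (\sum_(s < N) s.+1%:R ^+ 2 * r ^+ s) =
  1 + r - r ^+ N * (N%:R ^+ 2 * (1 - r) ^+ 2 + 2 * N%:R * (1 - r) + (1 + r)).
  elim: N => [|N IH]; first by rewrite big_ord0; ring.
  rewrite big_ord_recr /= mulrDr IH [r ^+ N.+1]exprS -[N.+1%:R]natr1; ring.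
suff : 0 <= r ^+ N * (N%:R ^+ 2 * (1 - r) ^+ 2 + 2 * N%:R * (1 - r) + (1 + r)) by lra.
have q0 : 0 <= 1 - r by rewrite subr_ge0.
apply: mulr_ge0; first exact: exprn_ge0.
apply: addr_ge0; last exact: addr_ge0.
by apply: addr_ge0; rewrite mulr_ge0 ?exprn_ge0 // mulr_ge0.
Qed.

Lemma hit_contra (n : nat) (l l' : lit n) (d : clause_draw n 2) :
  hit (neg l') (neg l) d = hit l l' d.
Proof. by rewrite /hit !negK orbC. Qed.

(** All disjointness of events in the two moment arguments rests on this: apart from contraposition,
    distinct implications need distinct clauses. *)
Lemma hit_same_clause (n : nat) (l l' k k' : lit n) (d : clause_draw n 2) :
  hit l l' d -> hit k k' d -> (k = l /\ k' = l') \/ (k = neg l' /\ k' = neg l).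
Proof.
have negI : injective (@neg n) by apply: inv_inj; exact: negK.
rewrite /hit => /orP[]/eqP -> /orP[]; rewrite xpair_eqE => /andP[/eqP e1 /eqP e2].
- by left; rewrite e2 (negI _ _ e1).
- by right; rewrite -e1 e2 negK.
- by right; rewrite e1 -e2 negK.
- by left; rewrite e1 (negI _ _ e2).
Qed.

Section Implications.
Context (n m : nat).
Implicit Type w : {ffun 'I_m -> clause_draw n 2}.

Definition imp w : rel (lit n) := fun l l' => [exists i, hit l l' (w i)].

Lemma imp_contra w l l' : imp w l l' -> imp w (neg l') (neg l).
Proof. by case/existsP=> i h; apply/existsP; exists i; rewrite hit_contra. Qed.

Lemma imp_holds_clause w (x : {ffun 'I_n -> bool}) :
  (forall l l', imp w l l' -> holds x l -> holds x l') ->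
  forall i, holds x (clause_pair (w i)).1 || holds x (clause_pair (w i)).2.
Proof.
move=> Hx i; case E: (clause_pair (w i)) => [a b] /=.
have := Hx (neg a) b; rewrite holds_neg.
have -> : imp w (neg a) b by apply/existsP; exists i; rewrite /hit E negK eqxx.
by case: (holds x a) => //= ->.
Qed.

Lemma satisfiableP w :
  reflect (exists x, forall l l', imp w l l' -> holds x l -> holds x l')
    (satisfiable (formula_of w)).
Proof.
have clauseE (x : {ffun 'I_n -> bool}) i :
    [exists j : 'I_2, x (formula_of w i j).1 == (formula_of w i j).2] =
    holds x (clause_pair (w i)).1 || holds x (clause_pair (w i)).2.
  rewrite /formula_of ffunE /holds /clause_pair /=.
  apply/existsP/orP => [[[[|[|//]] h] e]|[] e].
  - by left; rewrite (_ : ord0 = Ordinal h) //; exact: val_inj.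
  - by right; rewrite (_ : ord_max = Ordinal h) //; exact: val_inj.
  - by exists ord0.
  - by exists ord_max.
apply: (iffP existsP) => -[x Hx]; exists x.
  move=> l l' /existsP[i h] hl; have /forallP/(_ i) := Hx; rewrite clauseE.
  by case/orP: h => /eqP -> /=; rewrite holds_neg hl ?orbF.
apply/forallP => i; rewrite clauseE; exact: imp_holds_clause.
Qed.

Lemma unsat_bicycle w : ~~ satisfiable (formula_of w) ->
  exists u q v, [/\ path (imp w) u (rcons q v), uniq (map fst q), neg u \in q &
    v.1 \in map fst q].
Proof.
move=> ns; have [[x /andP[c1 c2]]|nc] :=
    pselect (exists x, connect (imp w) x (neg x) && connect (imp w) (neg x) x).
  exact: bicycle c1 c2.
case/negP: ns; apply/satisfiableP; apply: exists_model; first exact: imp_contra.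
by move=> l; apply/negP => h; apply: nc; exists l.
Qed.

End Implications.

Section FirstMoment.
Context (R : realType) (n : nat) (p : R) (p_ge0 : 0 <= p) (p_le1 : p <= 1).
Context (n_gt1 : (1 < n)%N).
Notation edge_prob := (edge_prob R n).
Notation hit_mass := (@hit_mass R n p).

Fixpoint path_mass (l : lit n) (q : seq (lit n)) : R :=
  if q is x :: q' then hit_mass l x * path_mass x q' else 1.

Lemma path_mass_ge0 l q : 0 <= path_mass l q.
Proof. by elim: q l => //= x q IH l; rewrite mulr_ge0 // hit_mass_ge0. Qed.

Lemma path_massE l q :
  \prod_(a < size q) hit_mass (nth l (l :: q) a) (nth l q a) = path_mass l q.
Proof.
elim: q l => [|x q IH] l; first by rewrite big_ord0.
rewrite /= big_ord_recl /=; congr (_ * _); rewrite -IH; apply: eq_bigr => a _.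
rewrite /=; congr (hit_mass _ _); apply: set_nth_default => //=.
  exact: ltnW (ltn_ord a).
exact: ltn_ord.
Qed.

Lemma path_mass_rcons l q v :
  path_mass l (rcons q v) = path_mass l q * hit_mass (last l q) v.
Proof.
by elim: q l => [|x q IH] l /=; rewrite ?mul1r ?mulr1 // IH mulrA.
Qed.

Lemma sum_path_mass l s : \sum_(q : s.-tuple (lit n)) path_mass l q <= n%:R^-1 ^+ s.
Proof.
elim: s l => [|s IH] l.
  by rewrite (big_pred1 [tuple]) //= => t; apply/esym/eqP; exact: tuple0.
rewrite (reindex (fun xq : lit n * s.-tuple (lit n) => [tuple of xq.1 :: xq.2])) /=; last first.
  exists (fun t : s.+1.-tuple (lit n) => (thead t, [tuple of behead t])) => [[x q] _|t _].
    by rewrite theadE; congr (_, _); exact: val_inj.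
  by rewrite -tuple_eta.
rewrite -(pair_bigA _ (fun x (q : s.-tuple (lit n)) => hit_mass l x * path_mass x q)) /=.
apply: (@le_trans _ _ (\sum_x hit_mass l x * n%:R^-1 ^+ s)).
  by apply: ler_sum => x _; rewrite -mulr_sumr ler_wpM2l ?hit_mass_ge0.
by rewrite -mulr_suml exprS ler_wpM2r ?exprn_ge0 ?invr_ge0 ?hit_mass_row.
Qed.

(** Since the variables of [q] are distinct, a shared clause leaves two cases. Either two
    consecutive edges are contrapositive, which makes a literal its own negation, or the first and
    last edges coincide, which puts [u] in [q] beside [neg u]. *)
Lemma bicycle_disjoint (u v : lit n) (q : seq (lit n)) :
  uniq (map fst q) -> neg u \in q ->
  let z := u :: rcons q v in
  forall a b d, (a < b <= size q)%N ->
    hit (nth u z a) (nth u z a.+1) d -> ~~ hit (nth u z b) (nth u z b.+1) d.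
Proof.
move=> uq uq' z a b d /andP[ab bq] hd; apply/negP => /(hit_same_clause hd).
have [N NE] : exists N, size q = N by exists (size q).
rewrite NE in bq.
have pr i : (0 < i <= N)%N -> (i.-1 < N)%N by lia.
have zE i : (0 < i <= N)%N -> nth u z i = nth u q i.-1.
  by rewrite -NE; case: i => // i /andP[_ iq]; rewrite /= nth_rcons iq.
have zq i : (0 < i <= N)%N -> nth u z i \in q.
  by move=> iq; rewrite zE // mem_nth // NE pr.
have zinj i j : (0 < i <= N)%N -> (0 < j <= N)%N ->
    (nth u z i).1 = (nth u z j).1 -> i = j.
  move=> iq jq; rewrite !zE // -!(nth_map u u.1 fst) ?NE ?pr //.
  by move/eqP; rewrite nth_uniq ?size_map ?NE ?pr // => /eqP; lia.
have nz (l : lit n) : l = neg l -> False.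
  by move/esym/eqP; apply/negP/neg_neq.
case=> -[e1 e2].
  case: a => [|a] in ab e1 e2 hd *; last first.
    suff : b = a.+1 by lia.
    by apply: zinj; rewrite ?e1 //; lia.
  have bE : b = N.
    apply/eqP; rewrite eqn_leq bq leqNgt; apply/negP => bq'.
    suff : b.+1 = 1%N by lia.
    by apply: zinj; rewrite ?e2 //; lia.
  have uz : u \in q by rewrite [u](esym e1) zq //; lia.
  by have /nz := uniq_map_inj uq uz uq' erefl.
have ba : b = a.+1 by apply: zinj; rewrite ?e1 //; lia.
by move: e1; rewrite ba => /nz.
Qed.

(** The inner edges keep their exact masses, to be summed over signs later; the two end edges, whose
    endpoints [u] and [v] are tied to the path, are bounded by [edge_prob] each. *)
Lemma Pr_bicycle m (u v x : lit n) (q : seq (lit n)) :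
  uniq (map fst (x :: q)) -> neg u \in x :: q ->
  Pr (@draw_prob R n 2 p) (fun w : {ffun 'I_m -> clause_draw n 2} =>
    path (imp w) u (rcons (x :: q) v)) <=
  m%:R ^+ (size q).+2 * (edge_prob ^+ 2 * path_mass x q).
Proof.
move=> uq uq'; set z := rcons (x :: q) v.
have sz : size z = (size q).+2 by rewrite size_rcons.
have mu_ge0 := draw_prob_ge0 (n := n) p_ge0 p_le1.
apply: (@le_trans _ _ (m%:R ^+ (size z) *
   \prod_(a < size z) hit_mass (nth u (u :: z) a) (nth u z a))).
  apply: (@le_trans _ _ (Pr (@draw_prob R n 2 p) (fun w : {ffun 'I_m -> clause_draw n 2} =>
    [forall a : 'I_(size z), [exists i, hit (nth u (u :: z) a) (nth u z a) (w i)]]))).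
    by apply: Pr_le => // w /(pathP u) hw; apply/forallP => a; exact: hw.
  apply: (@Pr_distinct_slots _ _ _ mu_ge0 (draw_mass_total p n_gt1) _ m
    (fun a : 'I_(size z) => hit (nth u (u :: z) a) (nth u z a))) => a b d.
  have sq : size (x :: q) = (size z).-1 by rewrite sz.
  wlog ab : a b / (a < b)%N => [W|_] ha.
    case: (ltngtP a b) (ha) => [ab _|ba _|/val_inj ->]; rewrite ?eqxx //; first exact: W.
    move=> hd; apply/negP => hb; move: hd; apply/negP.
    by apply: W hb => //; rewrite eq_sym.
  apply: (@bicycle_disjoint u v (x :: q) uq uq' a b d) ha.
  by rewrite ab sq; have := ltn_ord b; lia.
rewrite path_massE sz ler_wpM2l ?exprn_ge0 // /z path_mass_rcons /= expr2.
rewrite mulrAC; apply: ler_wpM2r; first exact: path_mass_ge0.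
by apply: ler_pM; rewrite ?hit_mass_ge0 ?hit_mass_le.
Qed.

Lemma card_neg_mem (q : seq (lit n)) :
  (#|[pred u : lit n | neg u \in q]| <= size q)%N.
Proof.
rewrite -(size_map (@neg n)); apply: leq_trans (card_size _).
apply: subset_leq_card; apply/fintype.subsetP => u; rewrite inE => uq.
by apply/mapP; exists (neg u); rewrite ?negK.
Qed.

Lemma card_var_mem (q : seq (lit n)) :
  (#|[pred v : lit n | v.1 \in map fst q]| <= 2 * size q)%N.
Proof.
rewrite mul2n -addnn -{2}(size_map (@neg n)) -size_cat.
apply: leq_trans (card_size _); apply: subset_leq_card; apply/fintype.subsetP => v.
rewrite inE mem_cat => /mapP[l lq /esym vl].
by case: (same_var vl) => ->; rewrite ?lq // map_f ?orbT.
Qed.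

Lemma unsat_prob_le (m : nat) : (m < n)%N ->
  unsat_prob n 2 p m <= 32 * n%:R ^+ 2 / (n%:R - m%:R) ^+ 3.
Proof.
move=> mn.
have mu_ge0 := draw_prob_ge0 (n := n) p_ge0 p_le1.
pose T s := (lit n * s.-tuple (lit n) * (lit n * lit n))%type.
pose ends (q : seq (lit n)) (uv : lit n * lit n) :=
  (neg uv.1 \in q) && (uv.2.1 \in map fst q).
pose good s (t : T s) := uniq (map fst (t.1.1 :: t.1.2)) && ends (t.1.1 :: t.1.2) t.2.
pose B s (t : T s) (w : {ffun 'I_m -> clause_draw n 2}) :=
  path (imp w) t.2.1 (rcons (t.1.1 :: t.1.2) t.2.2).
(* The path has [s + 1] inner literals: [2 n] choices for the first, a total mass of [n ^ (- s)] for
   the rest, [s + 1] choices for [u] and [2 (s + 1)] for [v]. *)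
pose b s := m%:R ^+ s.+2 * edge_prob ^+ 2 * (4 * n%:R * s.+1%:R ^+ 2 * n%:R^-1 ^+ s) : R.
have Bb (s : nat) : \sum_(t : T s | good s t) Pr (@draw_prob R n 2 p) (B s t) <= b s.
  pose c : R := m%:R ^+ s.+2 * edge_prob ^+ 2.
  have c0 : 0 <= c by rewrite mulr_ge0 ?exprn_ge0 ?edge_prob_ge0.
  (* Distinctness of the variables has served to place the edges in distinct clauses; it is now
     dropped so that the sum over paths can be taken one literal at a time. *)
  apply: (@le_trans _ _ (\sum_(t : T s | ends (t.1.1 :: t.1.2) t.2) c * path_mass t.1.1 t.1.2)).
    rewrite [leLHS]big_mkcond [leRHS]big_mkcond /=; apply: ler_sum => -[[x q] [u v]] _.
    rewrite /good /=; case: ifPn => [/andP[uq /andP[uq' vq]]|_].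
      rewrite /ends /= uq' vq /=; apply: le_trans (Pr_bicycle m v uq uq') _.
      by rewrite size_tuple /c mulrA.
    by case: ifP => // _; rewrite mulr_ge0 ?path_mass_ge0.
  rewrite -(pair_big_dep predT (fun xq : lit n * s.-tuple (lit n) => ends (xq.1 :: xq.2))
    (fun xq _ => c * path_mass xq.1 xq.2)) /=.
  apply: (@le_trans _ _ (\sum_(xq : lit n * s.-tuple (lit n))
      c * path_mass xq.1 xq.2 * (s.+1 * (2 * s.+1))%:R)).
    apply: ler_sum => -[x q] _ /=; rewrite sumr_const -[leLHS]mulr_natr.
    apply: ler_wpM2l; first by rewrite mulr_ge0 ?path_mass_ge0.
    rewrite ler_nat.
    have := leq_mul (card_neg_mem (x :: q)) (card_var_mem (x :: q)).
    rewrite /= size_tuple -cardX; apply: leq_trans.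
    by apply: subset_leq_card; apply/fintype.subsetP => -[u v]; rewrite /ends !inE.
  rewrite -mulr_suml -mulr_sumr -(pair_bigA _ (fun x (q : s.-tuple (lit n)) => path_mass x q)) /=.
  rewrite /b -/c -mulrA; apply: ler_wpM2l => //.
  apply: (@le_trans _ _ ((2 * n)%:R * n%:R^-1 ^+ s * (s.+1 * (2 * s.+1))%:R)).
    apply: ler_wpM2r => //; rewrite -(_ : #|{: lit n}| = (2 * n)%N); last first.
      by rewrite card_prod card_ord card_bool mulnC.
    rewrite mulr_natl -sumr_const; apply: ler_sum => x _; exact: sum_path_mass.
  by rewrite !natrM le_eqVlt; apply/orP; left; apply/eqP; ring.
apply: (@le_trans _ _ (\sum_(s < n) b s)).
  apply: (@le_trans _ _ (\sum_(s < n) \sum_(t : T s | good s t)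
      Pr (@draw_prob R n 2 p) (B s t))); last first.
    by apply: ler_sum => s _; exact: Bb.
  apply: (@le_trans _ _ (\sum_(s < n) Pr (@draw_prob R n 2 p)
      (fun w => [exists t : T s, good s t && B s t w]))); last first.
    apply: ler_sum => s _; apply: Pr_union => // w /existsP[t tP].
    by apply/hasP; exists t => //; exact: mem_index_enum.
  rewrite /unsat_prob /formula_prob; apply: Pr_union => // w.
  move=> /unsat_bicycle[u [[|x q] [v [pq uq uq' vq]]]] //.
  have sn : (size q < n)%N.
    have := max_card [in map fst (x :: q)]; rewrite card_ord.
    by have /card_uniqP -> := uq; rewrite /= size_map.
  apply/hasP; exists (Ordinal sn); first exact: mem_index_enum.
  apply/existsP; exists ((x, in_tuple q), (u, v)).
  by rewrite /good /ends /B /= in uq uq' vq pq *; rewrite uq uq' vq pq.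
have n0 : 0 < n%:R :> R by rewrite ltr0n; lia.
have d0 : 0 < n%:R - m%:R :> R by rewrite subr_gt0 ltr_nat.
pose r : R := m%:R / n%:R.
have r1 : r <= 1 by rewrite ler_pdivrMr // mul1r ler_nat ltnW.
have r0 : 0 <= r by rewrite divr_ge0.
have := sum_sqr_geometric_le n r0 r1.
set S := \sum_(s < n) _ => HS.
have -> : \sum_(s < n) b s = 4 * n%:R * m%:R ^+ 2 * edge_prob ^+ 2 * S.
  rewrite /S mulr_sumr; apply: eq_bigr => s _.
  rewrite /b /r expr_div_n [m%:R ^+ s.+2]exprS [m%:R ^+ s.+1]exprS exprVn; ring.
(* The left side is [m / (n - 1)], and [m <= n - 1]. *)
have mh : m%:R * n%:R * edge_prob <= 1.
  rewrite edge_probE invfM mulrA mulfK ?gt_eqF //.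
  by rewrite ler_pdivrMr ?mul1r ?ler_nat ?ltr0n; lia.
have mh0 : 0 <= m%:R * n%:R * edge_prob by rewrite !mulr_ge0 ?edge_prob_ge0.
have S0 : 0 <= S by apply: sumr_ge0 => s _; rewrite mulr_ge0 ?exprn_ge0.
rewrite ler_pdivlMr ?exprn_gt0 //.
have dE : (n%:R - m%:R : R) = n%:R * (1 - r).
  by rewrite /r mulrBr mulr1 mulrCA divff ?mulr1 // gt_eqF.
rewrite dE.
have -> : 4 * n%:R * m%:R ^+ 2 * edge_prob ^+ 2 * S * (n%:R * (1 - r)) ^+ 3 =
  4 * n%:R ^+ 2 * (m%:R * n%:R * edge_prob) ^+ 2 * ((1 - r) ^+ 3 * S) by ring.
have : (m%:R * n%:R * edge_prob) ^+ 2 * ((1 - r) ^+ 3 * S) <= 1 * 2.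
  apply: ler_pM; rewrite ?exprn_ge0 ?exprn_ile1 // mulr_ge0 // exprn_ge0 //.
  by rewrite subr_ge0.
set Y := _ ^+ 2 * (_ * _) => HY.
rewrite -mulrA -/Y [leRHS](_ : _ = 4 * n%:R ^+ 2 * 8); last by ring.
by apply: ler_wpM2l; [rewrite mulr_ge0 ?exprn_ge0|lra].
Qed.

End FirstMoment.

(** * Long paths by depth-first search *)

Lemma bernoulli_le (R : realFieldType) (x : R) (k : nat) :
  0 <= x -> x <= 1 -> 1 - k%:R * x <= (1 - x) ^+ k.
Proof.
move=> x0 x1; elim: k => [|k IH]; first by rewrite mul0r subr0.
rewrite exprSr; apply: le_trans (_ : (1 - k%:R * x) * (1 - x) <= _).
  rewrite -natr1 (_ : (1 - k%:R * x) * (1 - x) = 1 - (k%:R + 1) * x + k%:R * x * x).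
    by rewrite lerDl !mulr_ge0.
  by ring.
by rewrite ler_wpM2r // subr_ge0.
Qed.

Definition hit_from (n : nat) (q : lit n * 'I_n) (d : clause_draw n 2) : bool :=
  hit q.1 (q.2, true) d || hit q.1 (q.2, false) d.

Lemma hit_from_exists (n : nat) (q : lit n * 'I_n) (d : clause_draw n 2) :
  hit_from q d -> exists s, hit q.1 (q.2, s) d.
Proof. by case/orP=> h; [exists true|exists false]. Qed.

(** The second alternative is the contrapositive. The search excludes it by querying only from
    visited literals to unvisited variables, so its queries are disjoint events. *)
Lemma hit_from_same_clause (n : nat) (q q' : lit n * 'I_n) (d : clause_draw n 2) :
  hit_from q d -> hit_from q' d -> q' = q \/ q'.1.1 = q.2.
Proof.
move=> /hit_from_exists[s h] /hit_from_exists[s' h'].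
case: (hit_same_clause h h') => -[e1 e2]; last by right; rewrite e1.
by left; case: q q' {h h'} e1 e2 => [w y] [w' y'] /= -> [->].
Qed.

Section Exploration.
Context (R : realType) (n m : nat) (p : R) (p_ge0 : 0 <= p) (p_le1 : p <= 1).
Context (n_gt1 : (1 < n)%N).
Notation edge_prob := (edge_prob R n).
Notation hit_mass := (@hit_mass R n p).
Notation mu := (@draw_prob R n 2 p).
Let mu_ge0 := draw_prob_ge0 (n := n) p_ge0 p_le1.
Let mu1 := draw_mass_total p n_gt1.
Implicit Types (st vl : seq (lit n)) (A : seq (lit n * 'I_n))
  (T : {ffun 'I_m -> option (lit n * lit n)}) (w : {ffun 'I_m -> clause_draw n 2}).

Lemma mass_hit_from (q : lit n * 'I_n) : q.1.1 != q.2 -> mass mu (hit_from q) = edge_prob.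
Proof.
move=> ne; rewrite -(hit_mass_sum p_ge0 p_le1 ne) mass_or // => d h.
apply/negP => h'; case: (hit_same_clause h h') => -[]; first by move=> _ [].
by move/(congr1 fst) => /= e; rewrite e eqxx in ne.
Qed.

Definition missed A : pred (clause_draw n 2) := fun d => ~~ has (fun q => hit_from q d) A.

(* The draws compatible with what has been revealed: slot [i] is known to give
   the implication [T i], or else is only known to miss the queries in [A]. *)
Definition compatible A T w : bool :=
  [forall i, if T i is Some e then hit e.1 e.2 (w i) else missed A (w i)].

(** The arguments are reversed because the stack lists its deepest literal first. *)
Definition found T (x y : lit n) : bool := [exists i, T i == Some (y, x)].

Context (L v0 : nat).

Definition long_path w : bool :=
  [exists s : L.-tuple (lit n), uniq (map fst s) && sorted (imp w) s].

Context (z c K : R).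
Context (z0 : 0 <= z) (c0 : 0 <= c) (K0 : 0 <= K).
Context (v0n : (v0 <= n)%N) (v0m : (v0 <= m)%N).
Context (K_large : forall a b,
  ((v0 - L) * (n - v0) <= a)%N -> (b <= v0)%N -> 1 <= K * z ^+ b * c ^+ a).
(** The cost of one failed query: at most [v0] slots get revealed, so at least [m - v0] others must
    miss it. *)
Notation y0 := ((1 - edge_prob) ^+ (m - v0)).
Context (balance : z * (m%:R * edge_prob) + c * y0 <= 1).

(* [weight A T] bounds the probability that the search fails from a given state:
   the terminal states satisfy this, and by [balance] one query does not increase
   the total weight.  A success reveals a slot, hence costs a union bound over at
   most [m] slots; [z] and [c] tilt the successes and failures as in a Chernoff
   bound. *)
Definition weight A T : R :=
  K * (\prod_i (if T i is Some e then z * hit_mass e.1 e.2 else 1)) * (c * y0) ^+ size A.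

(* The states of the search: [st] is the stack, deepest literal first, which is a
   path of revealed implications, [vl] lists the visited literals and [A] the
   queries that failed.  A literal leaves the stack only when its queries to all
   unvisited variables have failed. *)
Record valid st vl A T : Prop := Valid {
  vl_uniq : uniq (map fst vl);
  st_sub : subseq st vl;
  st_path : sorted (found T) st;
  A_uniq : uniq A;
  A_vl : forall q, q \in A -> q.1 \in vl;
  A_done : forall l y, l \in vl -> l \notin st -> y \notin map fst vl -> (l, y) \in A;
  T_card : (#|[pred i | T i : bool]| <= size vl)%N;
  A_mass : mass mu (missed A) = 1 - (size A)%:R * edge_prob }.

Lemma y0_ge0 : 0 <= y0.
Proof. by rewrite exprn_ge0 // subr_ge0 (edge_prob_le1 R n_gt1). Qed.

Lemma weight_ge0 A T : 0 <= weight A T.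
Proof.
rewrite /weight !mulr_ge0 ?exprn_ge0 ?mulr_ge0 ?y0_ge0 //.
by apply: prodr_ge0 => i _; case: (T i) => // e; rewrite mulr_ge0 ?hit_mass_ge0.
Qed.

Lemma Pr_compatible A T : mass mu (missed A) = 1 - (size A)%:R * edge_prob ->
  Pr mu (compatible A T) =
  \prod_i (if T i is Some e then hit_mass e.1 e.2 else 1) *
  (1 - (size A)%:R * edge_prob) ^+ (m - #|[pred i | T i : bool]|).
Proof.
move=> AE.
pose G i : pred (clause_draw n 2) :=
  fun d => if T i is Some e then hit e.1 e.2 d else missed A d.
transitivity (\prod_i mass mu (G i)); first by rewrite -Pr_rect.
have -> : (m - #|[pred i | T i : bool]|)%N = #|[pred i | ~~ T i]|.
  have := cardC [pred i | T i : bool]; rewrite card_ord => E.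
  by rewrite -[X in (X - _)%N]E addKn.
rewrite -prodr_const [X in _ = _ * X]big_mkcond -big_split /=.
apply: eq_bigr => i _; rewrite /G inE.
by case: (T i) => [e|] /=; rewrite ?mulr1 ?mul1r.
Qed.

(** The counting step of the search: at least [v0 - L] visited literals have left the stack, and
    each has failed against all [n - v0] unvisited variables. *)
Lemma A_large st vl A T : valid st vl A T -> size vl = v0 -> (size st <= L)%N ->
  ((v0 - L) * (n - v0) <= size A)%N.
Proof.
move=> V vlE stL.
pose S := [seq l <- vl | l \notin st]; pose U := [seq y <- enum 'I_n | y \notin map fst vl].
have uvl : uniq vl := map_uniq (vl_uniq V).
have SS : (v0 - L <= size S)%N.
  have : (size [seq l <- vl | l \in st] <= size st)%N.
    apply: uniq_leq_size; first exact: filter_uniq.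
    by move=> l; rewrite mem_filter => /andP[].
  have := count_predC (mem st) vl; rewrite /S !size_filter vlE.
  rewrite (eq_count (a1 := [in st]) (a2 := mem st)) //.
  rewrite (eq_count (a1 := predC [in st]) (a2 := fun l => l \notin st)) //.
  lia.
have SU : (n - v0 <= size U)%N.
  have : (size [seq y <- enum 'I_n | y \in map fst vl] <= size vl)%N.
    rewrite -(size_map fst vl); apply: uniq_leq_size; first by rewrite filter_uniq ?enum_uniq.
    by move=> l; rewrite mem_filter => /andP[].
  have := count_predC [in map fst vl] (enum 'I_n); rewrite -cardE card_ord /U !size_filter vlE.
  rewrite (eq_count (a1 := predC [in map fst vl]) (a2 := fun y => y \notin map fst vl)) //.
  by lia.
apply: leq_trans (leq_mul SS SU) _; rewrite -(size_allpairs pair).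
apply: uniq_leq_size.
  apply: allpairs_uniq; [exact: filter_uniq|exact: filter_uniq (enum_uniq _)|].
  by move=> -[? ?] [? ?] _ _ [-> ->].
move=> q /allpairsP[[l y] /= [lS yU ->]].
move: lS yU; rewrite !mem_filter => /andP[lst lvl] /andP[yvl _].
exact: (A_done V).
Qed.

Lemma weight_final st vl A T : valid st vl A T -> size vl = v0 -> (size st <= L)%N ->
  Pr mu (compatible A T) <= weight A T.
Proof.
move=> V vlE stL; rewrite (Pr_compatible _ (A_mass V)) /weight.
set b := #|_|; set P1 := \prod_i _; set P2 := \prod_i _.
have bv : (b <= v0)%N by rewrite -vlE; exact: (T_card V).
have P1_ge0 : 0 <= P1.
  by apply: prodr_ge0 => i _; case: (T i) => // e; rewrite hit_mass_ge0.
have P2E : P2 = z ^+ b * P1.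
  rewrite /b -prodr_const [X in _ = X * _]big_mkcond -big_split /=.
  by apply: eq_bigr => i _; rewrite inE; case: (T i) => [e|] /=; rewrite ?mulr1.
have a0 : 0 <= 1 - (size A)%:R * edge_prob by rewrite -(A_mass V) mass_ge0.
apply: (@le_trans _ _ (P1 * y0 ^+ size A)).
  rewrite ler_wpM2l // exprAC; apply: (@le_trans _ _ ((1 - (size A)%:R * edge_prob) ^+ (m - v0))).
    apply: ler_wiXn2l => //; first by rewrite gerBl mulr_ge0 ?edge_prob_ge0.
    by rewrite leq_sub2l.
  apply: lerXn2r; rewrite ?nnegrE ?exprn_ge0 ?subr_ge0 ?(edge_prob_le1 R n_gt1) //.
    by rewrite -subr_ge0.
  exact: bernoulli_le (edge_prob_ge0 _ _) (edge_prob_le1 R n_gt1).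
rewrite P2E exprMn; have k1 := K_large (A_large V vlE stL) bv.
have -> : K * (z ^+ b * P1) * (c ^+ size A * y0 ^+ size A) =
    K * z ^+ b * c ^+ size A * (P1 * y0 ^+ size A) by ring.
by rewrite ler_peMl // mulr_ge0 // exprn_ge0 // y0_ge0.
Qed.

Lemma stack_long st vl A T w : valid st vl A T -> (L <= size st)%N ->
  compatible A T w -> long_path w.
Proof.
move=> V Lst /forallP cw; apply/existsP.
have sz : size (rev (take L st)) == L by rewrite size_rev size_takel.
exists (Tuple sz) => /=; apply/andP; split.
  rewrite map_rev rev_uniq map_take take_uniq //.
  exact: subseq_uniq (map_subseq fst (st_sub V)) (vl_uniq V).
rewrite rev_sorted; apply: take_sorted; apply: sub_sorted (st_path V) => x y /existsP[i /eqP Ti].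
by apply/existsP; exists i; have := cw i; rewrite Ti.
Qed.

Definition extend T (i : 'I_m) e : {ffun 'I_m -> option (lit n * lit n)} :=
  [ffun j => if j == i then Some e else T j].

Lemma weight_extend A T i e : T i = None ->
  weight A (extend T i e) = weight A T * (z * hit_mass e.1 e.2).
Proof.
move=> Ti; rewrite /weight (bigD1 i) //= [in RHS](bigD1 i) //= Ti ffunE eqxx.
rewrite mul1r (eq_bigr (fun j => if T j is Some e then z * hit_mass e.1 e.2 else 1)).
  by ring.
by move=> j ji; rewrite ffunE (negPf ji).
Qed.

(** Several slots may hit [q], so this is a union bound. A state revealing slot [i] keeps only the
    hit there, forgets that the slot missed [A], and does not record [q] as failed. *)
Lemma query_split A T q (F : pred {ffun 'I_m -> clause_draw n 2}) :
  Pr mu (fun w => compatible A T w && F w) <=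
  Pr mu (fun w => compatible (q :: A) T w && F w) +
  \sum_(i | ~~ T i) (Pr mu (fun w => compatible A (extend T i (q.1, (q.2, true))) w && F w) +
                     Pr mu (fun w => compatible A (extend T i (q.1, (q.2, false))) w && F w)).
Proof.
pose E i s w := compatible A (extend T i (q.1, (q.2, s))) w && F w.
pose G i w := E i true w || E i false w.
pose F' w := compatible (q :: A) T w && F w.
apply: (@le_trans _ _ (Pr mu F' + \sum_(i | ~~ T i) Pr mu (G i))); last first.
  rewrite lerD2l; apply: ler_sum => i _.
  exact: (Pr_or mu_ge0 (E := G i) (F := E i true) (G := E i false)).
apply: (@le_trans _ _ (Pr mu F' + Pr mu (fun w => [exists i, ~~ T i && G i w]))); last first.
  rewrite lerD2l; apply: Pr_union => // w /existsP[i Gi].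
  by apply/hasP; exists i => //; exact: mem_index_enum.
apply: Pr_or => // w /andP[cw Fw] /=; rewrite /F' Fw andbT.
case: (boolP [exists i, ~~ T i && hit_from q (w i)]) => [/existsP[i /andP[Ti]]|nex].
  move=> /hit_from_exists[s h]; apply/orP; right; apply/existsP; exists i; rewrite Ti /=.
  have : E i s w.
    rewrite /E Fw andbT; apply/forallP => j; rewrite ffunE.
    by case: (eqVneq j i) => [->//|_]; exact: (forallP cw).
  by rewrite /G; case: s {h} => ->; rewrite ?orbT.
apply/orP; left; apply/forallP => j; have := forallP cw j.
case Tj: (T j) => [//|] mj; rewrite /missed /= negb_or; apply/andP; split=> //.
by move: nex; rewrite negb_exists => /forallP/(_ j); rewrite Tj.
Qed.

Lemma valid_miss l st vl A T y : valid (l :: st) vl A T -> y \notin map fst vl ->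
  (l, y) \notin A -> valid (l :: st) vl ((l, y) :: A) T.
Proof.
move=> V yv lyA; have lvl : l \in vl by apply: (mem_subseq (st_sub V)); rewrite mem_head.
have ly : l.1 != y by apply: contraNneq yv => <-; exact: map_f.
case: V => V1 V2 V3 V4 V5 V6 V7 V8; split=> //=.
- by rewrite lyA.
- by move=> q; rewrite inE => /orP[/eqP -> //|]; exact: V5.
- by move=> a b av ast bv; rewrite inE V6 ?orbT.
- have disj d : hit_from (l, y) d -> missed A d.
    move=> h; apply/hasPn => q qA; apply/negP => h'.
    case: (hit_from_same_clause h h') => [e|e]; first by rewrite -e qA in lyA.
    by move: yv; rewrite -[y]/((l, y).2) -e map_f // V5.
  have : mass mu (missed A) = mass mu (hit_from (l, y)) + mass mu (missed ((l, y) :: A)).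
    rewrite -mass_or => [|d]; last by rewrite /missed /= negb_or => ->.
    apply: eq_bigl => d; rewrite /missed /= negb_or -/(missed A d).
    by case: (boolP (hit_from _ _)) => [/disj|].
  rewrite V8 mass_hit_from // -natr1 mulrDl mul1r => e; rewrite opprD addrA e.
  by rewrite addrC addKr.
Qed.

Lemma valid_hit l st vl A T i y s : valid (l :: st) vl A T -> y \notin map fst vl ->
  T i = None -> valid ((y, s) :: l :: st) ((y, s) :: vl) A (extend T i (l, (y, s))).
Proof.
move=> [V1 V2 V3 V4 V5 V6 V7 V8] yv Ti; split=> //=.
- by rewrite yv.
- by rewrite eqxx.
- apply/andP; split.
    by apply/existsP; exists i; rewrite ffunE eqxx.
  apply: sub_path V3 => a b /existsP[j /eqP Tj]; apply/existsP; exists j.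
  by rewrite ffunE; case: (eqVneq j i) => [e|_]; [rewrite -e Tj in Ti|rewrite Tj].
- by move=> q /V5; rewrite inE orbC => ->.
- move=> a b; rewrite !inE !negb_or => /orP[/eqP ->|av]; first by rewrite eqxx.
  by move=> /andP[_ ast] /andP[_ bv]; apply: V6 => //; rewrite inE negb_or.
- rewrite (cardD1 i) inE ffunE eqxx /= add1n ltnS; apply: leq_trans V7.
  apply: subset_leq_card; apply/fintype.subsetP => j; rewrite !inE ffunE.
  by case: eqP.
Qed.

Lemma valid_root vl A T y s : valid [::] vl A T -> y \notin map fst vl ->
  valid [:: (y, s)] ((y, s) :: vl) A T.
Proof.
move=> [V1 V2 V3 V4 V5 V6 V7 V8] yv; split=> //=.
- by rewrite yv.
- by rewrite eqxx; case: (vl).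
- by move=> q /V5; rewrite inE orbC => ->.
- move=> a b; rewrite !inE !negb_or => /orP[/eqP ->|av]; first by rewrite eqxx.
  by move=> ast /andP[_ bv]; apply: V6.
- exact: leqW.
Qed.

Lemma valid_pop l st vl A T : valid (l :: st) vl A T ->
  (forall y, y \notin map fst vl -> (l, y) \in A) -> valid st vl A T.
Proof.
move=> [V1 V2 V3 V4 V5 V6 V7 V8] ldone; split=> //.
- exact: subseq_trans (subseq_cons _ _) V2.
- exact: path_sorted V3.
- move=> a b av ast bv; case: (eqVneq a l) => [->|al]; first exact: ldone.
  by apply: V6; rewrite // inE negb_or al.
Qed.

(** Induction on a potential. A visit lowers the first term by 2 and lengthens the stack by 1, hence
    the factor 2; a pop shortens the stack, and a failed query enlarges [A], which has at most
    [2 * n * n] elements. *)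
Lemma exploration_bound k st vl A T :
  valid st vl A T -> (size vl <= v0)%N ->
  (2 * (n - size vl) + size st + (2 * n * n - size A) < k)%N ->
  Pr mu (fun w => compatible A T w && ~~ long_path w) <= weight A T.
Proof.
elim: k st vl A T => [//|k IH] st vl A T V vv hk.
case: (leqP L (size st)) => [Lst|stL].
  rewrite [leLHS](_ : _ = 0) ?weight_ge0 //; apply: big_pred0 => w.
  by apply/negP => /andP[cw /negP]; apply; apply: stack_long V Lst cw.
case: (ltngtP (size vl) v0) vv => // [vlt|vE] _; last first.
  apply: le_trans (weight_final V vE (ltnW stL)); apply: Pr_le => // w.
  by case/andP.
have [y yv] : exists y, y \notin map fst vl.
  apply/existsP; apply: contraLR vlt; rewrite negb_exists => /forallP all_vl.
  rewrite -leqNgt; apply: leq_trans v0n _.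
  rewrite -[leqLHS]size_enum_ord -(size_map fst); apply: uniq_leq_size (enum_uniq _) _ => y _.
  by have := all_vl y; rewrite negbK.
have Asz : forall A', uniq A' -> (size A' <= 2 * n * n)%N.
  move=> A' /card_uniqP <-; apply: leq_trans (max_card _) _.
  by rewrite !card_prod card_ord card_bool (mulnC n 2).
case: st => [|l st] in V hk stL *.
  apply: (IH [:: (y, true)] ((y, true) :: vl)) => //=; first exact: valid_root.
  by move: hk => /=; lia.
have [[y' /andP[yv' lyA]]|nex] := pselect (exists y', (y' \notin map fst vl) && ((l, y') \notin A)).
  have V' := valid_miss V yv' lyA.
  apply: le_trans (query_split A T (l, y') _) _ => /=.
  apply: (@le_trans _ _ (weight ((l, y') :: A) T + \sum_(i | ~~ T i)
     (weight A (extend T i (l, (y', true))) + weight A (extend T i (l, (y', false)))))).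
    apply: lerD.
      apply: (IH _ _ _ _ V') => //=; have := Asz _ (A_uniq V'); move: hk => /=; lia.
    apply: ler_sum => i; case Ti: (T i) => [//|] _.
    apply: lerD; apply: (IH _ _ _ _ (valid_hit _ V yv' Ti)) => //=; move: hk => /=; lia.
  have ly : l.1 != y'.
    apply: contraNneq yv' => <-; apply: map_f.
    by apply: (mem_subseq (st_sub V)); rewrite mem_head.
  rewrite (eq_bigr (fun=> weight A T * (z * edge_prob))); last first.
    move=> i; case Ti: (T i) => [//|] _; rewrite !weight_extend //=.
    by rewrite -mulrDr -mulrDr (hit_mass_sum p_ge0 p_le1 ly).
  rewrite sumr_const [weight (_ :: A) T](_ : _ = weight A T * (c * y0)); last first.
    by rewrite /weight /= exprSr mulrA.
  rewrite -mulrnAr -mulrDr ler_piMr ?weight_ge0 //.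
  apply: le_trans balance; rewrite addrC lerD2r -mulr_natr -mulrA ler_wpM2l //.
  rewrite mulrC ler_wpM2r ?edge_prob_ge0 // ler_nat.
  by apply: leq_trans (max_card _) _; rewrite card_ord.
apply: (IH st vl); [|exact: ltnW|by move: hk => /=; lia].
apply: valid_pop V _ => y' yv'; apply/negPn/negP => h; apply: nex.
by exists y'; rewrite yv'.
Qed.

Lemma Pr_no_long_path : Pr mu (fun w => ~~ long_path w) <= K.
Proof.
pose T0 : {ffun 'I_m -> option (lit n * lit n)} := [ffun=> None].
have V0 : valid [::] [::] [::] T0.
  split=> //.
    by rewrite eq_card0 // => i; rewrite inE ffunE.
  by rewrite mul0r subr0 -mu1.
have := exploration_bound V0 (leq0n _) (ltnSn _).
rewrite /weight big1 => [|i _]; last by rewrite ffunE.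
rewrite !mulr1; apply: le_trans; apply: Pr_le => // w wn; rewrite wn andbT.
by apply/forallP => i; rewrite ffunE.
Qed.

End Exploration.

(** * Closing a long path *)

Section Closing.
Context (R : realType) (n : nat) (p : R) (p_ge0 : 0 <= p) (p_le1 : p <= 1).
Context (n_gt1 : (1 < n)%N).
Notation edge_prob := (edge_prob R n).
Notation mu := (@draw_prob R n 2 p).
Let mu_ge0 := draw_prob_ge0 (n := n) p_ge0 p_le1.
Let mu1 := draw_mass_total p n_gt1.

Definition both_in (S : {set lit n}) (d : clause_draw n 2) : bool :=
  ((clause_pair d).1 \in S) && ((clause_pair d).2 \in S).

Lemma same_sign_subset (X : {set lit n}) : exists S : {set lit n},
  [/\ S \subset X, {in S &, forall a b : lit n, a.2 = b.2} & (#|X| <= 2 * #|S|)%N].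
Proof.
pose S b := [set l in X | l.2 == b].
have sX b : S b \subset X by apply/fintype.subsetP => l; rewrite inE => /andP[].
have sgn b : {in S b &, forall a a' : lit n, a.2 = a'.2}.
  by move=> a a'; rewrite !inE => /andP[_ /eqP ->] /andP[_ /eqP ->].
have cX : (#|X| = #|S true| + #|S false|)%N.
  rewrite -(cardsID [set l | l.2 == true] X); congr (_ + _)%N; apply: eq_card => l.
    by rewrite !inE.
  by rewrite !inE andbC; case: (l.2).
case: (leqP #|S true| #|S false|) => h; [exists (S false)|exists (S true)];
  split=> //; rewrite cX; lia.
Qed.

Lemma exp_le_inv (x : R) (k : nat) : 0 <= x -> x <= 1 -> (1 - x) ^+ k <= (1 + k%:R * x)^-1.
Proof.
move=> x0 x1; have d k' : 0 < 1 + k'%:R * x by rewrite ltr_wpDr // mulr_ge0.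
rewrite -div1r ler_pdivlMr //; elim: k => [|k IH]; first by rewrite mul0r addr0 mulr1.
rewrite exprSr -mulrA; apply: le_trans IH; rewrite ler_wpM2l ?exprn_ge0 ?subr_ge0 //.
rewrite -natr1 (_ : (1 - x) * _ = 1 + k%:R * x - (k%:R * x * x + x * x)); last by ring.
by rewrite gerBl addr_ge0 ?mulr_ge0.
Qed.

Lemma Pr_none_in (S : {set lit n}) (r m : nat) :
  {in S &, forall a b : lit n, a.2 = b.2} -> (r <= #|S|)%N ->
  Pr mu (fun w : {ffun 'I_m -> clause_draw n 2} => [forall i, ~~ both_in S (w i)]) <=
  (1 + m%:R * ((r * r.-1)%:R * (edge_prob / 4)))^-1.
Proof.
move=> sS rS; have hm := mass_same_sign p sS.
set k := _ * (edge_prob / 4).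
have k0 : 0 <= k by rewrite mulr_ge0 // divr_ge0 // edge_prob_ge0.
have km : k <= mass mu (both_in S).
  apply: le_trans hm; rewrite ler_wpM2r ?divr_ge0 ?edge_prob_ge0 // ler_nat.
  by apply: leq_mul => //; lia.
have k1 : k <= 1 := le_trans km (mass_le1 mu_ge0 mu1 _).
apply: le_trans (exp_le_inv m k0 k1).
rewrite (Pr_rect mu (fun _ d => ~~ both_in S d)) massC // prodr_const card_ord.
by apply: lerXn2r; rewrite ?nnegrE ?subr_ge0 ?mass_le1 // lerD2l lerN2.
Qed.

(* A satisfying assignment is nondecreasing along the path [s], so the two
   clauses force the second half of [s] to be both true and not all true. *)
Lemma closed_path_unsat m (w : {ffun 'I_m -> clause_draw n 2}) (s : seq (lit n)) h
    (S1 S2 : {set lit n}) :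
  sorted (imp w) s -> {subset S1 <= take h s} -> {subset S2 <= map (@neg n) (drop h s)} ->
  [exists i, both_in S1 (w i)] -> [exists i, both_in S2 (w i)] ->
  ~~ satisfiable (formula_of w).
Proof.
move=> ps sub1 sub2 /existsP[i /andP[i1 i2]] /existsP[j /andP[j1 j2]].
apply/negP => /satisfiableP[x Hx].
have mono l l' : l \in take h s -> l' \in drop h s -> holds x l -> holds x l'.
  move=> lt ld; have : pairwise (fun l l' => holds x l ==> holds x l') s.
    rewrite -sorted_pairwise.
      by apply: sub_sorted ps => a b ab; apply/implyP; exact: Hx.
    by move=> a b d /implyP ba /implyP ad; apply/implyP => /ba.
  rewrite -{1}(cat_take_drop h s) pairwise_cat => /and3P[/allrelP/(_ _ _ lt ld)/implyP].
  by move=> h1 _ _; exact: h1.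
have drop_true l : l \in drop h s -> holds x l.
  move=> ld; have := imp_holds_clause Hx i.
  by case/orP; apply: mono => //; apply: sub1.
have neg_false l : l \in S2 -> ~~ holds x l.
  by move=> /sub2/mapP[l' ld ->]; rewrite holds_neg negbK drop_true.
by have := imp_holds_clause Hx j; rewrite (negPf (neg_false _ j1)) (negPf (neg_false _ j2)).
Qed.

Lemma imp_cat m1 m2 (u : {ffun 'I_m1 -> clause_draw n 2}) (v : {ffun 'I_m2 -> clause_draw n 2}) :
  subrel (imp u) (imp (catf (u, v))).
Proof.
move=> l l' /existsP[i h]; apply/existsP; exists (lshift m2 i).
by have /ffunP/(_ i) := fst_catf (u, v); rewrite ffunE => ->.
Qed.

(** Each half of the path has [2 * r] literals, of which at least [r] share a sign; restricting to
    these gives a bound valid for every [p]. The factor 2 accounts for the two closing clauses,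
    looked for in the last [m2] clauses with the first [m1] fixed. *)
Lemma sat_prob_le m1 m2 r :
  sat_prob n 2 p (m1 + m2) <=
  Pr mu (fun u : {ffun 'I_m1 -> clause_draw n 2} => ~~ long_path (4 * r) u) +
  2 * (1 + m2%:R * ((r * r.-1)%:R * (edge_prob / 4)))^-1.
Proof.
set b := (1 + _)^-1.
have b0 : 0 <= b.
  by rewrite invr_ge0 addr_ge0 // !mulr_ge0 // invr_ge0.
pose F (w : {ffun 'I_(m1 + m2) -> clause_draw n 2}) :=
  long_path (4 * r) (fstf w) && satisfiable (formula_of w).
apply: (@le_trans _ _ (Pr mu (fun w : {ffun 'I_(m1 + m2) -> clause_draw n 2} =>
    ~~ long_path (4 * r) (fstf w)) + Pr mu F)).
  apply: Pr_or => // w; rewrite /F => sw.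
  by case: (long_path _ _).
rewrite (Pr_fst mu1 m2 (fun u => ~~ long_path (4 * r) u)) lerD2l.
apply: (Pr_cond mu_ge0 mu1) => u; rewrite /F.
case: (boolP (long_path (4 * r) u)) => [/existsP[s /andP[us ps]]|nl]; last first.
  rewrite [leLHS](_ : _ = 0) ?mulr_ge0 //; apply: big_pred0 => v.
  by rewrite fst_catf (negPf nl).
have [S1 [S1s S1g S1c]] := same_sign_subset [set l in take (2 * r) s].
have [S2 [S2s S2g S2c]] := same_sign_subset [set l in map (@neg n) (drop (2 * r) s)].
have us' : uniq s := map_uniq us.
have r1 : (r <= #|S1|)%N.
  have : #|[set l in take (2 * r) s]| = (2 * r)%N.
    have /card_uniqP := take_uniq (2 * r) us'; rewrite size_takel ?size_tuple; last by lia.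
    by move=> E; rewrite -[RHS]E; apply: eq_card => l; rewrite inE.
  by move: S1c => /[swap] ->; lia.
have r2 : (r <= #|S2|)%N.
  have : #|[set l in map (@neg n) (drop (2 * r) s)]| = (2 * r)%N.
    have : uniq (map (@neg n) (drop (2 * r) s)).
      by rewrite (map_inj_uniq (inv_inj (@negK n))) drop_uniq.
    move/card_uniqP; rewrite size_map size_drop size_tuple.
    rewrite (_ : (4 * r - 2 * r)%N = (2 * r)%N); last by lia.
    by move=> E; rewrite -[RHS]E; apply: eq_card => l; rewrite inE.
  by move: S2c => /[swap] ->; lia.
have -> : 2 * b = b + b by ring.
apply: (@le_trans _ _
   (Pr mu (fun v : {ffun 'I_m2 -> clause_draw n 2} => [forall i, ~~ both_in S1 (v i)]) +
    Pr mu (fun v : {ffun 'I_m2 -> clause_draw n 2} => [forall i, ~~ both_in S2 (v i)])));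
  last first.
  by apply: lerD; apply: Pr_none_in.
apply: Pr_or => // v /andP[_]; apply: contraLR.
rewrite negb_or !negb_forall => /andP[e1 e2].
have lift_ex (S : {set lit n}) : [exists i, ~~ ~~ both_in S (v i)] ->
    [exists i, both_in S (catf (u, v) i)].
  case/existsP=> i; rewrite negbK => h; apply/existsP; exists (rshift m1 i).
  by have /ffunP/(_ i) := snd_catf (u, v); rewrite ffunE => ->.
apply: (@closed_path_unsat _ _ s (2 * r) S1 S2) => //; try exact: lift_ex.
- exact: sub_sorted (imp_cat v) _ ps.
- by move=> l /(fintype.subsetP S1s); rewrite inE.
- by move=> l /(fintype.subsetP S2s); rewrite inE.
Qed.

Lemma sat_prob_antitone m m' : (m <= m')%N -> sat_prob n 2 p m' <= sat_prob n 2 p m.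
Proof.
move/subnKC => <-; set k := (m' - m)%N.
change (Pr mu (fun w : {ffun 'I_(m + k) -> clause_draw n 2} => satisfiable (formula_of w)) <=
  Pr mu (fun w : {ffun 'I_m -> clause_draw n 2} => satisfiable (formula_of w))).
rewrite -(Pr_fst mu1 k (fun w : {ffun 'I_m -> clause_draw n 2} => satisfiable (formula_of w))).
apply: Pr_le => // w.
move=> /satisfiableP[x Hx]; apply/satisfiableP; exists x => l l' ll'; apply: Hx.
by move: ll'; rewrite -{2}(catf_fs w); exact: imp_cat.
Qed.

Lemma unsat_probE m : unsat_prob n 2 p m = 1 - sat_prob n 2 p m.
Proof. exact: (PrC mu1). Qed.

Lemma sat_prob_ge0 m : 0 <= sat_prob n 2 p m.
Proof. exact: Pr_ge0. Qed.

End Closing.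

(** * Choice of the parameters *)

Lemma expRN_le_inv (R : realType) (t : R) : 0 <= t -> expR (- t) <= (1 + t)^-1.
Proof.
move=> t0; have t1 : 0 < 1 + t by lra.
by rewrite expRN lef_pV2 ?posrE ?expR_gt0 // expR_ge1Dx.
Qed.

Lemma expRN_le (R : realType) (t : R) : 0 <= t -> expR (- t) <= 1 - t + t ^+ 2.
Proof.
move=> t0; apply: le_trans (expRN_le_inv t0) _.
rewrite -div1r ler_pdivrMr; last by lra.
have : 0 <= t ^+ 3 by rewrite exprn_ge0.
suff -> : (1 - t + t ^+ 2) * (1 + t) = 1 + t ^+ 3 by lra.
ring.
Qed.

Section Numerics.
Context (R : realFieldType).

(** To first order the clause excess [8 u] outweighs the losses [3 u] and [u]; a net gain of [u / 2]
    is all that is kept. *)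
Lemma quartic_lower_bound (u : R) : 0 <= u -> 24 * u <= 1 ->
  1 + u / 2 <= (1 + 8 * u) * (1 - 3 * u) * ((1 - u) * (1 - u ^+ 2)).
Proof.
move=> u0 u1.
have h1 : 1 + 4 * u <= (1 + 8 * u) * (1 - 3 * u) by nra.
have h2 : 1 - 2 * u <= (1 - u) * (1 - u ^+ 2) by nra.
apply: le_trans (_ : (1 + 4 * u) * (1 - 2 * u) <= _); first by nra.
apply: ler_pM => //; nra.
Qed.

(* [V] visited literals, a path of [L] literals and [M] clauses, with [u] the
   tilt; [h] is [edge_prob] and [g] is the logarithm of [c] in the search. *)
Lemma exponent_bound (N V L M h u : R) :
  0 < u -> 24 * u <= 1 -> 16 <= N * u ^+ 2 -> h * (N * (N - 1)) = 1 ->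
  0 <= L -> 0 <= V -> V <= N * u ^+ 2 -> L <= V * u ->
  N * (1 + 8 * u) <= M -> M <= 2 * N ->
  let g := M * h * (u - u ^+ 2) - h * V - 4 * (M * h) ^+ 2 in
  0 <= g /\ u * V - g * ((V - L) * (N - V)) <= - (u ^+ 2 / 2 * V).
Proof.
move=> u0 u1 uN hN L0 V0 VN LV MN M2 g.
have N16 : 16 <= N by nra.
have N0 : 0 < N by lra.
have NN : 0 < N * (N - 1) by rewrite mulr_gt0 //; lra.
have hE : h = (N * (N - 1))^-1 by rewrite -[h](mulfK (lt0r_neq0 NN)) hN mul1r.
have h0 : 0 < h by rewrite hE invr_gt0.
have hN1 : h * (N - 1) = N^-1.
  by rewrite hE invfM mulfVK // gt_eqF //; lra.
have hNN : 1 <= h * N ^+ 2 by rewrite -hN; nra.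
have M0 : 0 < M by nra.
have hM : 4 * (M * h) <= u ^+ 2.
  have : 4 * (M * h) * N <= 16.
    have : h * N <= 2 * N^-1 by rewrite -hN1; nra.
    have : N^-1 * N = 1 by rewrite mulVf // gt_eqF.
    nra.
  nra.
have gE : g = h * (M * (u - u ^+ 2) - V - M * (4 * (M * h))) by rewrite /g; ring.
(* The three losses in [g], namely [u ^+ 2] itself, the term in [V] and the quadratic term, each
   cost at most [h * M * u ^+ 2]. *)
have g1 : h * (M * (u - 3 * u ^+ 2)) <= g.
  rewrite gE; apply: ler_wpM2l; first exact: ltW.
  have : M * (4 * (M * h)) <= M * u ^+ 2 by apply: ler_wpM2l => //; exact: ltW.
  have : N * u ^+ 2 <= M * u ^+ 2 by nra.
  nra.
have uu : 0 <= u - 3 * u ^+ 2 by nra.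
have g2 : h * N * ((1 + 8 * u) * (u - 3 * u ^+ 2)) <= g.
  apply: le_trans g1.
  rewrite (_ : h * N * _ = h * (N * (1 + 8 * u) * (u - 3 * u ^+ 2))); last by ring.
  by apply: ler_wpM2l; [exact: ltW|exact: ler_wpM2r].
have g0 : 0 <= h * N * ((1 + 8 * u) * (u - 3 * u ^+ 2)).
  by rewrite !mulr_ge0 // ?ltW //; lra.
split; first exact: le_trans g2.
have A1 : V * (1 - u) * (N * (1 - u ^+ 2)) <= (V - L) * (N - V).
  by apply: ler_pM; rewrite ?mulr_ge0 //; nra.
have A0 : 0 <= V * (1 - u) * (N * (1 - u ^+ 2)).
  by rewrite !mulr_ge0 //; nra.
have := ler_pM g0 A0 g2 A1.
have -> : h * N * ((1 + 8 * u) * (u - 3 * u ^+ 2)) * (V * (1 - u) * (N * (1 - u ^+ 2)))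
  = (h * N ^+ 2) * (u * V * ((1 + 8 * u) * (1 - 3 * u) * ((1 - u) * (1 - u ^+ 2)))).
  by ring.
have uV : 0 <= u * V by rewrite mulr_ge0 // ltW.
have P := ler_wpM2l uV (quartic_lower_bound (ltW u0) u1).
have P0 : 0 <= u * V * (1 + u / 2) by rewrite mulr_ge0 //; lra.
have Q := ler_pM ler01 P0 hNN P.
move=> S; have := le_trans Q S; rewrite mul1r => T.
have -> : u ^+ 2 / 2 * V = u * V * (1 + u / 2) - u * V by ring.
lra.
Qed.

End Numerics.

Lemma cube_ge (R : realFieldType) (J : R) : 24 <= J -> 16 * J <= J ^+ 3.
Proof.
move=> J24; have J0 : 0 <= J by lra.
by rewrite (exprSr _ 2) ler_wpM2r // expr2; nra.
Qed.

Lemma cube_le (R : realFieldType) (J V : R) : 24 <= J -> J ^+ 6 <= V + 1 -> J ^+ 3 <= V.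
Proof.
move=> J24; have := cube_ge J24; have -> : J ^+ 6 = J ^+ 3 * J ^+ 3 by ring.
move: (J ^+ 3) => c cJ hc; have c2 : 2 <= c by lra.
have : 2 * c <= c * c by rewrite ler_wpM2r //; lra.
lra.
Qed.

Lemma quotient_pred_ge (R : realFieldType) (J V N r : R) :
  24 <= J -> J ^+ 3 <= V -> N < (V + 1) * J ^+ 2 -> V < (r + 1) * (4 * J) ->
  N <= (r - 1) * (16 * J ^+ 3).
Proof.
move=> J24 V3 V2 R2; have J0 : 0 < J by lra.
have V16 : 16 * J <= V := le_trans (cube_ge J24) V3.
have h : V + 1 <= (r - 1) * (4 * J) * 4 by lra.
have -> : (r - 1) * (16 * J ^+ 3) = (r - 1) * (4 * J) * 4 * J ^+ 2 by ring.
by apply: le_trans (ltW V2) _; rewrite ler_wpM2r // exprn_ge0 // ltW.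
Qed.

Lemma inv_add1_le (R : realFieldType) (J t a : R) :
  0 < J -> 0 < a -> J <= a * t -> (1 + t)^-1 <= a / J.
Proof.
move=> J0 a0 Jt; have t0 : 0 < t by rewrite -(pmulr_rgt0 _ a0) (lt_le_trans J0).
rewrite -[a / J]invf_div lef_pV2 ?posrE ?divr_gt0 ?addr_gt0 //.
by rewrite ler_pdivrMr // mulrC (le_trans Jt) // ler_pM2l // lerDr.
Qed.

(** Bound both exponentials to second order. The linear terms cancel, and the extra [4 * x ^+ 2] in
    [t] pays for [t ^+ 2], since [t <= 2 * x]. This is the origin of the quadratic term in [g]. *)
Lemma expRN_balance (R : realType) (x u t : R) :
  0 <= x -> 0 <= u -> u <= 1 -> 4 * x <= 1 -> t = x * (1 - u + u ^+ 2) + 4 * x ^+ 2 ->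
  expR (- u) * x + expR (- t) <= 1.
Proof.
move=> x0 u0 u1 x1 tE.
have a1 : 0 <= x * (1 - u + u ^+ 2) by apply: mulr_ge0 => //; have := sqr_ge0 u; lra.
have a2 : 0 <= x * (u * (1 - u)) by rewrite !mulr_ge0 // subr_ge0.
have a3 : 0 <= x * (1 - 4 * x) by rewrite mulr_ge0 // subr_ge0.
have t0 : 0 <= t by rewrite tE; have := sqr_ge0 x; lra.
have t2 : t <= 2 * x by rewrite tE; lra.
have := ler_wpM2r x0 (expRN_le u0); have := expRN_le t0.
have : t ^+ 2 <= (2 * x) ^+ 2.
  by apply: lerXn2r => //; rewrite nnegrE // mulr_ge0.
rewrite exprMn; lra.
Qed.

(** The search bound with [z = expR (- u)] and [c = expR g]. The exponent on the right makes
    [K_large] an equality in the extreme case of [v0] successes and [(v0 - L) * (n - v0)]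
    failures. *)
Lemma Pr_no_long_path_expR (R : realType) (n m L v0 : nat) (p u : R) :
  0 <= p -> p <= 1 -> (1 < n)%N -> (v0 <= n)%N -> (v0 <= m)%N -> (L <= v0)%N ->
  0 <= u -> u <= 1 -> 4 * (m%:R * edge_prob R n) <= 1 ->
  let g := m%:R * edge_prob R n * (u - u ^+ 2) - edge_prob R n * v0%:R -
    4 * (m%:R * edge_prob R n) ^+ 2 in
  0 <= g ->
  Pr (@draw_prob R n 2 p) (fun w : {ffun 'I_m -> clause_draw n 2} => ~~ long_path L w) <=
  expR (u * v0%:R - g * ((v0%:R - L%:R) * (n%:R - v0%:R))).
Proof.
move=> p0 p1 n1 v0n v0m Lv u0 u1 x1 g g0.
have AE : (v0%:R - L%:R) * (n%:R - v0%:R) = ((v0 - L) * (n - v0))%:R :> R.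
  by rewrite natrM !natrB.
apply: (@Pr_no_long_path R n m p p0 p1 n1 L v0 (expR (- u)) (expR g)) => //; try exact: expR_ge0.
- move=> a b ha hb; rewrite -!expRM_natl -!expRD -[leLHS]expR0 ler_expR AE.
  have : 0 <= g * (a%:R - ((v0 - L) * (n - v0))%:R) by rewrite mulr_ge0 // subr_ge0 ler_nat.
  have : 0 <= u * (v0%:R - b%:R) by rewrite mulr_ge0 // subr_ge0 ler_nat.
  lra.
- have hm : (1 - edge_prob R n) ^+ (m - v0) <= expR (- ((m%:R - v0%:R) * edge_prob R n)).
    rewrite -natrB // -mulrN expRM_natl; apply: lerXn2r; rewrite ?nnegrE ?expR_ge0 //.
      by rewrite subr_ge0 (edge_prob_le1 R n1).
    exact: expR_ge1Dx.
  apply: le_trans (_ : expR (- u) * (m%:R * edge_prob R n) +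
     expR (- ((m%:R - v0%:R) * edge_prob R n - g)) <= _).
    rewrite lerD2l.
    have -> : - ((m%:R - v0%:R) * edge_prob R n - g) =
        g + - ((m%:R - v0%:R) * edge_prob R n) by ring.
    by rewrite [leRHS]expRD ler_wpM2l ?expR_ge0.
  apply: expRN_balance => //; first by rewrite mulr_ge0 ?edge_prob_ge0.
  by rewrite /g; ring.
Qed.

(** With [u = 1 / j], the sizes [v0] and [4 * r] are, up to rounding, the largest that
    [exponent_bound] allows. The search then fails with probability at most [expR (- j / 2)]; the
    hypothesis [j ^ 8 <= n] is what closing the path requires. *)
Lemma sat_prob_small (R : realType) (n m j : nat) (p : R) :
  0 <= p -> p <= 1 -> (24 <= j)%N -> (j ^ 8 <= n)%N ->
  (n + (9 * n) %/ j + n %/ j <= m)%N ->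
  sat_prob n 2 p m <= 5000 / j%:R.
Proof.
move=> p0 p1 j24 jn hm.
have jn2 : (16 * (j * j) <= n)%N.
  apply: leq_trans jn; rewrite mulnn (expnD j 6 2) leq_mul //.
  apply: (@leq_trans (j ^ 1)%N); first by rewrite expn1; lia.
  by rewrite leq_pexp2l //; lia.
have j0 : (0 < j)%N by apply: leq_trans j24.
have jj0 : (0 < j * j)%N by rewrite muln_gt0 j0.
have j40 : (0 < 4 * j)%N by rewrite muln_gt0.
have n1 : (1 < n)%N.
  by apply: leq_trans jn2; rewrite -[2%N]muln1 leq_mul.
have n0 : (0 < n)%N by apply: ltnW.
pose v0 := (n %/ (j * j))%N; pose r := (v0 %/ (4 * j))%N.
pose D := ((9 * n) %/ j)%N; pose m2 := (n %/ j)%N.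
apply: le_trans (sat_prob_antitone p0 p1 n1 hm) _.
apply: le_trans (sat_prob_le p0 p1 n1 (n + D) m2 r) _.
pose J : R := j%:R; pose N : R := n%:R; pose V : R := v0%:R; pose u := J^-1.
have J24 : 24 <= J by rewrite (ler_nat R 24).
have J0 : 0 < J by lra.
have uJ : u * J = 1 by rewrite mulVf // gt_eqF.
have u0 : 0 < u by rewrite invr_gt0.
have NJ : 16 * J ^+ 2 <= N by rewrite /J expr2 -!natrM ler_nat.
have NJ8 : J ^+ 8 <= N by rewrite /J -natrX ler_nat.
have V1 : V * J ^+ 2 <= N by rewrite /J expr2 -!natrM ler_nat leq_divM.
have V2 : N < (V + 1) * J ^+ 2.
  by rewrite /J expr2 natr1 -!natrM ltr_nat ltn_ceil.
have D1 : D%:R * J <= 9 * N by rewrite /J -!natrM ler_nat leq_divM.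
have D2 : 9 * N < (D%:R + 1) * J.
  by rewrite /J natr1 -!natrM ltr_nat ltn_ceil.
have M2 : N < (m2%:R + 1) * J by rewrite /J natr1 -!natrM ltr_nat ltn_ceil.
have R1 : r%:R * (4 * J) <= V by rewrite /J -!natrM ler_nat leq_divM.
have R2 : V < (r%:R + 1) * (4 * J).
  by rewrite /J natr1 -!natrM ltr_nat ltn_ceil.
have N0 : 0 < N by rewrite ltr0n.
have hh : edge_prob R n * (N * (N - 1)) = 1.
  rewrite /N -[X in _ * (_ * (_ - X))]/(1%:R) -natrB // -natrM.
  by rewrite /edge_prob subn1 mulVf // pnatr_eq0 -lt0n muln_gt0 n0 -subn1 subn_gt0.
have Vu : V <= N * u ^+ 2.
  by rewrite /u exprVn ler_pdivlMr // exprn_gt0.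
have uN : 16 <= N * u ^+ 2 by rewrite /u exprVn ler_pdivlMr // exprn_gt0.
have u24 : 24 * u <= 1 by rewrite ler_pdivrMr // mul1r.
have Lu : (4 * r)%:R <= V * u by rewrite /u ler_pdivlMr // natrM; lra.
(* The excess is [9 n / j] rather than [8 n / j] to absorb the rounding down. *)
have MN : N * (1 + 8 * u) <= (n + D)%:R.
  rewrite natrD mulrDr mulr1 lerD2l mulrA ler_pdivrMr //; nra.
have M2N : (n + D)%:R <= 2 * N.
  rewrite natrD -/N; suff : D%:R <= N by lra.
  rewrite -(ler_pM2r J0); nra.
have [g0 gE] := exponent_bound u0 u24 uN hh (ler0n R (4 * r)) (ler0n R v0) Vu Lu MN M2N.
have v0n : (v0 <= n)%N by rewrite leq_div.
have x1 : 4 * ((n + D)%:R * edge_prob R n) <= 1.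
  suff : 4 * (2 * N * edge_prob R n) <= 1.
    by apply: le_trans; rewrite ler_pM2l // ler_wpM2r ?edge_prob_ge0.
  have hN : edge_prob R n * (N - 1) * N = 1 by rewrite -[RHS]hh; ring.
  rewrite -(ler_pM2r (_ : 0 < N - 1)); last by nra.
  have -> : 4 * (2 * N * edge_prob R n) * (N - 1) = 8 * (edge_prob R n * (N - 1) * N) by ring.
  by rewrite hN; nra.
have Lv : (4 * r <= v0)%N.
  apply: leq_trans (leq_divM v0 (4 * j)); rewrite -/r mulnC leq_mul2l.
  by rewrite leq_pmulr ?orbT.
have u1 : u <= 1 by lra.
have P := Pr_no_long_path_expR p0 p1 n1 v0n (leq_trans v0n (leq_addr _ _)) Lv (ltW u0) u1 x1 g0.
have J2 : 0 < J ^+ 2 by rewrite exprn_gt0.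
have V3 : J ^+ 3 <= V.
  have : J ^+ 6 <= V + 1.
    by rewrite -(ler_pM2r J2) -exprD; apply: ltW; exact: le_lt_trans V2.
  exact: cube_le.
(* [2048 = 4 * 2 * 16 ^ 2]: the 4 from the equal-sign bound, 2 from rounding [m2], 16 from rounding
   [r]. The search error gets what remains of 5000. *)
have -> : 5000 / J = 904 / J + 2 * (2048 / J) by clear; lra.
apply: lerD.
  apply: (le_trans P); apply: (@le_trans _ _ (expR (- (u ^+ 2 / 2 * V)))).
    by rewrite ler_expR.
  have uV : J / 2 <= u ^+ 2 / 2 * V.
    have := ler_wpM2l (ltW (exprn_gt0 2 u0)) V3.
    have -> : u ^+ 2 * J ^+ 3 = (u * J) ^+ 2 * J by ring.
    by rewrite uJ expr1n mul1r => h; rewrite [leRHS]mulrAC; apply: ler_wpM2r; rewrite ?invr_ge0.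
  have uV0 : 0 <= u ^+ 2 / 2 * V by apply: le_trans uV; rewrite divr_ge0 // ltW.
  apply: le_trans (expRN_le_inv uV0) _.
  apply: (inv_add1_le J0); first by rewrite ltr0n.
  by move: uV J0; clear; lra.
apply: ler_wpM2l => //.
set T := m2%:R * _.
have r1 : (1 <= r)%N.
  rewrite lt0n; apply: contraTneq R2 => ->; rewrite add0r mul1r -leNgt.
  by apply: le_trans V3; apply: le_trans (cube_ge J24); rewrite ler_pM2r // ler_nat.
pose q : R := r.-1%:R.
have qE : q = r%:R - 1 by rewrite /q -subn1 natrB.
have q1 : N <= q * (16 * J ^+ 3).
  by rewrite qE; exact: quotient_pred_ge V3 V2 R2.
have m2J : N <= m2%:R * (2 * J).
  have : 2 * J <= N by apply: le_trans NJ; rewrite expr2; move: J24; clear; nra.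
  by move: M2; lra.
have h1 : 1 <= edge_prob R n * N ^+ 2.
  by rewrite -[leLHS]hh ler_wpM2l ?edge_prob_ge0 // expr2 ler_pM2l // gerBl.
have TE : m2%:R * q ^+ 2 * edge_prob R n <= 4 * T.
  rewrite /T natrM -/q qE; have := edge_prob_ge0 R n; have : 0 <= m2%:R :> R by [].
  have : 1 <= r%:R :> R by rewrite (ler_nat R 1).
  move: (m2%:R) (r%:R) (edge_prob R n) => a b h b1 a0 hh0.
  have : 0 <= a * (b - 1) * h by rewrite !mulr_ge0 // subr_ge0.
  lra.
have big : J ^+ 8 <= 2048 * T * J ^+ 7.
  apply: le_trans NJ8 _; apply: (@le_trans _ _ (N * (edge_prob R n * N ^+ 2))).
    by rewrite ler_peMr // ltW.
  apply: (@le_trans _ _ (m2%:R * (2 * J) * (q * (16 * J ^+ 3)) ^+ 2 * edge_prob R n)).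
    rewrite (_ : N * _ = N * N ^+ 2 * edge_prob R n); last by ring.
    apply: ler_wpM2r; first exact: edge_prob_ge0.
    apply: ler_pM; [exact: ltW|by rewrite exprn_ge0 // ltW|exact: m2J|].
    by apply: lerXn2r; rewrite ?nnegrE; [exact: ltW|exact: le_trans (ltW N0) q1|exact: q1].
  rewrite (_ : _ * edge_prob R n = m2%:R * q ^+ 2 * edge_prob R n * (512 * J ^+ 7)); last by ring.
  rewrite (_ : 2048 * T * J ^+ 7 = 4 * T * (512 * J ^+ 7)); last by ring.
  apply: ler_wpM2r TE; apply: mulr_ge0; first exact: ler0n.
  by rewrite exprn_ge0 // ltW.
have JT : J <= 2048 * T.
  by move: big; rewrite (exprS J 7) ler_pM2r // exprn_gt0.
by apply: (inv_add1_le J0 _ JT); rewrite ltr0n.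
Qed.

(** * Asymptotics *)

Local Open Scope classical_set_scope.
Local Open Scope ring_scope.

Section Asymptotics.
Context (R : realType).

Lemma near_root_ge (A : R) : \forall n \near \oo, A <= n%:R `^ 10^-1.
Proof.
near=> n.
have [A0|A0] := leP A 0; first by apply: le_trans A0 (powR_ge0 _ _).
have -> : A = (A ^+ 10) `^ 10^-1.
  by rewrite -powR_mulrn ?ltW // -powRrM divff ?powRr1 ?ltW.
apply: ge0_ler_powR; rewrite ?nnegrE ?exprn_ge0 ?(ltW A0) //.
by near: n; exact: nbhs_infty_ger.
Unshelve. all: by end_near.
Qed.

Lemma root_exp (n : nat) : (n%:R `^ 10^-1) ^+ 10 = n%:R :> R.
Proof. by rewrite -powR_mulrn ?powR_ge0 // -powRrM mulVf ?powRr1. Qed.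

Lemma pow910E (n : nat) : n%:R `^ (9 / 10) = (n%:R `^ 10^-1) ^+ 9 :> R.
Proof. by rewrite -powR_mulrn ?powR_ge0 // -powRrM mulrC. Qed.

Lemma near_pow910_le (d : R) : 0 < d ->
  \forall n \near \oo, n%:R + n%:R `^ (9 / 10) <= (1 + d) * n%:R - 1.
Proof.
move=> d0; near=> n.
have g1 : 1 <= n%:R `^ 10^-1 :> R by near: n; exact: near_root_ge.
have g2 : 2 / d <= n%:R `^ 10^-1 by near: n; exact: near_root_ge.
have n2 : 2 / d <= n%:R by near: n; exact: nbhs_infty_ger.
have E := root_exp n; move: (pow910E n) => ->.
set g := n%:R `^ 10^-1 in g1 g2 E *.
have g9 : 0 <= g ^+ 9 by rewrite exprn_ge0 //; lra.
have : 2 * g ^+ 9 <= d * n%:R.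
  by rewrite -E [g ^+ 10]exprS mulrA ler_wpM2r // mulrC -ler_pdivrMr.
have : 2 <= d * n%:R by rewrite mulrC -ler_pdivrMr.
lra.
Unshelve. all: by end_near.
Qed.

Context (p : R) (p_ge0 : 0 <= p) (p_le1 : p <= 1).

Lemma near_sat_prob_le (e : R) : 0 < e ->
  \forall n \near \oo, forall m : nat,
    n%:R + n%:R `^ (9 / 10) <= m%:R :> R -> sat_prob n 2 p m <= e.
Proof.
move=> e0; near=> n => m.
have g3 : 3 <= n%:R `^ 10^-1 :> R by near: n; exact: near_root_ge.
(* Ensures [(11 * g) ^+ 8 <= g ^+ 10 = n], which gives [j ^ 8 <= n]. *)
have g11 : 11 ^+ 4 <= n%:R `^ 10^-1 :> R by near: n; exact: near_root_ge.
have ge : 5000 / e <= n%:R `^ 10^-1 by near: n; exact: near_root_ge.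
have E := root_exp n; rewrite pow910E.
set g := n%:R `^ 10^-1 in g3 g11 ge E *.
(* Just above [10 * g], so that the total excess [9 n / j + n / j] is at most [g ^+ 9], that is, [n]
   to the power 9/10. *)
move=> hm; pose j := (Num.truncn (10 * g)).+1.
have j1 : 10 * g < j%:R := truncnS_gt _.
have j2 : j%:R <= 11 * g.
  rewrite /j -[leLHS]natr1; have : (Num.truncn (10 * g))%:R <= 10 * g.
    by rewrite truncn_le; lra.
  lra.
have g0 : 0 < g by lra.
have J0 : 0 < j%:R :> R by lra.
have j24 : (24 <= j)%N by rewrite -(ler_nat R); lra.
have j8 : (j ^ 8 <= n)%N.
  rewrite -(ler_nat R) natrX -E.
  apply: (@le_trans _ _ ((11 * g) ^+ 8)).
    by apply: lerXn2r; rewrite ?nnegrE // ?ltW // mulr_gt0.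
  rewrite exprMn (exprD g 2 8) ler_wpM2r ?exprn_ge0 ?(ltW g0) //.
  rewrite (exprM 11 4 2); apply: lerXn2r; rewrite ?nnegrE ?exprn_ge0 ?(ltW g0) //.
have nm : (n + (9 * n) %/ j + n %/ j <= m)%N.
  rewrite -(ler_nat R); apply: le_trans hm; rewrite !natrD -addrA lerD2l.
  rewrite -(ler_pM2r J0) mulrDl.
  have d1 : ((9 * n) %/ j)%:R * j%:R <= 9 * n%:R :> R by rewrite -!natrM ler_nat leq_divM.
  have d2 : (n %/ j)%:R * j%:R <= n%:R :> R by rewrite -natrM ler_nat leq_divM.
  have : 10 * n%:R <= g ^+ 9 * j%:R.
    apply: (@le_trans _ _ (g ^+ 9 * (10 * g))).
      by rewrite -E le_eqVlt; apply/orP; left; apply/eqP; ring.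
    by rewrite ler_wpM2l ?exprn_ge0 ?(ltW g0) // ltW.
  lra.
apply: le_trans (sat_prob_small p_ge0 p_le1 j24 j8 nm) _.
rewrite ler_pdivrMr // mulrC -ler_pdivrMr //; apply: le_trans ge _.
lra.
Unshelve. all: by end_near.
Qed.

Lemma near_unsat_prob_le (d e : R) : 0 < d -> 0 < e ->
  \forall n \near \oo, forall m : nat,
    m%:R <= (1 - d) * n%:R -> unsat_prob n 2 p m <= e.
Proof.
move=> d0 e0; near=> n => m hm.
have n1 : (1 < n)%N by near: n; exact: nbhs_infty_gt.
have n0 : 0 < n%:R :> R by rewrite ltr0n ltnW.
have nA : 32 / (d ^+ 3 * e) <= n%:R by near: n; exact: nbhs_infty_ger.
have dn : 0 < d * n%:R by rewrite mulr_gt0.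
have mn : (m < n)%N by rewrite -(ltr_nat R); lra.
apply: le_trans (unsat_prob_le p_ge0 p_le1 n1 mn) _.
have dm : d * n%:R <= n%:R - m%:R by lra.
have dm0 : 0 < n%:R - m%:R :> R by lra.
have d3 : 0 < d ^+ 3 * e by rewrite mulr_gt0 // exprn_gt0.
rewrite ler_pdivrMr ?exprn_gt0 //.
apply: (@le_trans _ _ (e * (d * n%:R) ^+ 3)).
  rewrite ler_pdivrMr // in nA.
  rewrite (_ : e * _ = n%:R * (d ^+ 3 * e) * n%:R ^+ 2); last by ring.
  by rewrite ler_wpM2r // exprn_ge0 // ltW.
by rewrite ler_wpM2l ?(ltW e0) // lerXn2r // nnegrE ltW.
Unshelve. all: by end_near.
Qed.

Lemma median_threshold_cvg : median_threshold 2 p n @[n --> \oo] --> (1 : R).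
Proof.
apply/cvgrPdist_le => e e0; near=> n.
have n1 : (1 < n)%N by near: n; exact: nbhs_infty_gt.
have n0 : 0 < n%:R :> R by rewrite ltr0n ltnW.
(* Any bound below 1/2 would do: satisfiability must have probability strictly above 1/2 to exclude
   [m] from the set defining the median. *)
have H1 : forall m : nat, m%:R <= (1 - e) * n%:R -> unsat_prob n 2 p m <= 4^-1.
  by near: n; exact: near_unsat_prob_le.
have H2 : forall m : nat, n%:R + n%:R `^ (9 / 10) <= m%:R :> R -> sat_prob n 2 p m <= 2^-1.
  by near: n; exact: near_sat_prob_le.
have H3 : n%:R + n%:R `^ (9 / 10) <= (1 + e) * n%:R - 1.
  by near: n; exact: near_pow910_le.
have e1 : 0 <= (1 + e) * n%:R by apply: mulr_ge0; [apply: addr_ge0 => //|]; exact: ltW.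
pose m0 := Num.truncn ((1 + e) * n%:R).
have m0le : m0%:R <= (1 + e) * n%:R by rewrite truncn_le.
have m0gt : (1 + e) * n%:R < m0%:R + 1 by rewrite natr1; exact: truncnS_gt.
(* This makes the set nonempty, so the infimum is a minimum and not the default value 0. *)
have S0 : sat_prob n 2 p m0 <= 2^-1 by apply: H2; lra.
have [m [Sm mmin ->]] := median_threshold_min (ex_intro _ m0 S0).
have mle : m%:R <= (1 + e) * n%:R.
  by apply: le_trans m0le; rewrite ler_nat; exact: mmin.
have mge : (1 - e) * n%:R <= m%:R.
  rewrite leNgt; apply/negP => /ltW/H1; rewrite unsat_probE //; lra.
rewrite distrC ler_distl ler_pdivlMr // ler_pdivrMr //.
by rewrite mge mle.
Unshelve. all: by end_near.
Qed.

Lemma cvg_sat_prob1 (m : nat -> nat) :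
  (forall e : R, 0 < e -> \forall n \near \oo, unsat_prob n 2 p (m n) <= e) ->
  sat_prob n 2 p (m n) @[n --> \oo] --> (1 : R).
Proof.
move=> H; apply/cvgrPdist_le => e e0; near=> n.
have n1 : (1 < n)%N by near: n; exact: nbhs_infty_gt.
rewrite -unsat_probE // ger0_norm; first by near: n; exact: H.
by apply: Pr_ge0; exact: draw_prob_ge0.
Unshelve. all: by end_near.
Qed.

Lemma sharp_threshold : sharp_sat_threshold 2 p.
Proof.
(* Half of [e] covers the distance from the median to 1; the other half remains as a margin around
   [n]. *)
move=> e e0 m; have e2 : 0 < e / 2 by rewrite divr_gt0.
have /cvgrPdist_le/(_ _ e2) med := median_threshold_cvg.
have med_mul (n : nat) : `|1 - median_threshold 2 p n| <= e / 2 ->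
    (1 - e / 2) * n%:R <= median_threshold 2 p n * n%:R <= (1 + e / 2) * n%:R.
  by rewrite distrC ler_distl => /andP[h1 h2]; rewrite !ler_wpM2r.
split=> Hm.
  apply: cvg_sat_prob1 => d d0; near=> n.
  have H : forall k : nat, k%:R <= (1 - e / 2) * n%:R -> unsat_prob n 2 p k <= d.
    by near: n; exact: near_unsat_prob_le.
  have hm : (m n)%:R < (median_threshold 2 p n - e) * n%:R by near: n.
  have /med_mul/andP[_] : `|1 - median_threshold 2 p n| <= e / 2 by near: n.
  by move=> h; apply: H; lra.
apply/cvgrPdist_le => d d0; near=> n.
have n1 : (1 < n)%N by near: n; exact: nbhs_infty_gt.
have H : forall k : nat, n%:R + n%:R `^ (9 / 10) <= k%:R :> R -> sat_prob n 2 p k <= d.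
  by near: n; exact: near_sat_prob_le.
have H3 : n%:R + n%:R `^ (9 / 10) <= (1 + e / 2) * n%:R - 1.
  by near: n; exact: near_pow910_le.
have hm : (m n)%:R > (median_threshold 2 p n + e) * n%:R by near: n.
have /med_mul/andP[h _] : `|1 - median_threshold 2 p n| <= e / 2 by near: n.
rewrite unsat_probE // opprB addrC subrK ger0_norm; first by apply: H; lra.
by apply: sat_prob_ge0.
Unshelve. all: by end_near.
Qed.

Lemma sat_prob_cvg1 (m : nat -> nat) :
  (n%:R - (m n)%:R) / n%:R `^ (2 / 3) @[n --> \oo] --> (+oo : set_system R) ->
  sat_prob n 2 p (m n) @[n --> \oo] --> (1 : R).
Proof.
move=> /cvgryPge Hm; apply: cvg_sat_prob1 => e e0; near=> n.
have n1 : (1 < n)%N by near: n; exact: nbhs_infty_gt.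
have n0 : 0 < n%:R :> R by rewrite ltr0n ltnW.
(* With [A = 1 + 32 / e] one has both [32 <= e * A] and [A <= A ^+ 3], so the bound
   [32 n^2 / (n - m)^3] drops below [e]. *)
have A1 : 1 + 32 / e <= (n%:R - (m n)%:R) / n%:R `^ (2 / 3) by near: n; exact: Hm.
have b0 : 0 < n%:R `^ (2 / 3) :> R by rewrite powR_gt0.
have b3 : (n%:R `^ (2 / 3)) ^+ 3 = n%:R ^+ 2 :> R.
  by rewrite -powR_mulrn ?powR_ge0 // -powRrM mulfVK // powR_mulrn.
set b := n%:R `^ (2 / 3) in A1 b0 b3 *.
set A := 1 + 32 / e in A1 *.
have e32 : 0 < 32 / e by rewrite divr_gt0.
have A0 : 1 <= A by rewrite lerDl ltW.
have mnA : A * b <= n%:R - (m n)%:R by rewrite -ler_pdivlMr.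
have Ab : 0 < A * b by rewrite mulr_gt0 // (lt_le_trans _ A0).
have mn : (m n < n)%N by rewrite -(ltr_nat R) -subr_gt0 (lt_le_trans Ab).
apply: le_trans (unsat_prob_le p_ge0 p_le1 n1 mn) _.
rewrite ler_pdivrMr ?exprn_gt0 ?(lt_le_trans Ab) //.
apply: (@le_trans _ _ (e * (A * b) ^+ 3)).
  rewrite exprMn b3 [leRHS]mulrA; apply: ler_wpM2r; first by rewrite exprn_ge0.
  have eA : 32 <= e * A by rewrite mulrDr mulr1 mulrCA divff ?mulr1 ?gt_eqF // lerDr ltW.
  apply: le_trans eA _; rewrite ler_wpM2l ?(ltW e0) //.
  by rewrite exprS ler_peMr ?exprn_ege1 // (le_trans _ A0).
by rewrite ler_wpM2l ?(ltW e0) // lerXn2r // nnegrE ltW // (lt_le_trans Ab).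
Unshelve. all: by end_near.
Qed.

(** An excess of [n] to the power 9/10 already suffices, and it is below the stated window as soon
    as [ln n >= 1]. *)
Lemma sat_prob_cvg0 (m : nat -> nat) :
  ((m n)%:R - n%:R) / (n%:R * ln n%:R) `^ (9 / 10) @[n --> \oo]
    --> (+oo : set_system R) ->
  sat_prob n 2 p (m n) @[n --> \oo] --> (0 : R).
Proof.
move=> /cvgryPge Hm; apply/cvgrPdist_le => e e0; near=> n.
have n1 : (1 < n)%N by near: n; exact: nbhs_infty_gt.
have n0 : 0 < n%:R :> R by rewrite ltr0n ltnW.
have H : forall k : nat, n%:R + n%:R `^ (9 / 10) <= k%:R :> R -> sat_prob n 2 p k <= e.
  by near: n; exact: near_sat_prob_le.
have A1 : 1 <= ((m n)%:R - n%:R) / (n%:R * ln n%:R) `^ (9 / 10) :> R by near: n; exact: Hm.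
have ne : expR 1 <= n%:R :> R by near: n; exact: nbhs_infty_ger.
have ln1 : 1 <= ln n%:R :> R by rewrite -[leLHS](expRK 1) ler_ln ?posrE ?expR_gt0.
rewrite sub0r normrN ger0_norm; last by apply: sat_prob_ge0.
apply: H; rewrite addrC -lerBrDr.
have nl : 0 < n%:R * ln n%:R :> R by rewrite mulr_gt0 // (lt_le_trans _ ln1).
rewrite ler_pdivlMr ?powR_gt0 // mul1r in A1; apply: le_trans A1.
by apply: ge0_ler_powR; rewrite ?nnegrE ?(ltW n0) ?(ltW nl) ?divr_ge0 // ler_peMr // ltW.
Unshelve. all: by end_near.
Qed.

End Asymptotics.

Theorem theorem3 (R : realType) (p : R) (p_ge0 : 0 <= p) (p_le1 : p <= 1) :
  [/\ sharp_sat_threshold 2 p,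
      median_threshold 2 p n @[n --> \oo] --> (1 : R),
      forall m : nat -> nat, (forall n, (0 < m n)%N) ->
        (n%:R - (m n)%:R) / n%:R `^ (2 / 3) @[n --> \oo] --> (+oo : set_system R) ->
        sat_prob n 2 p (m n) @[n --> \oo] --> (1 : R),
      forall m : nat -> nat, (forall n, (0 < m n)%N) ->
        ((m n)%:R - n%:R) / (n%:R * ln n%:R) `^ (9 / 10) @[n --> \oo]
          --> (+oo : set_system R) ->
        sat_prob n 2 p (m n) @[n --> \oo] --> (0 : R) &
      threshold_density 2 p = 1 /\
      threshold_density 2 p = classical_threshold_density R 2].
Proof.
have density1 (q : R) : 0 <= q -> q <= 1 -> threshold_density 2 q = 1.
  by move=> q0 q1; apply: cvg_lim; [exact: norm_hausdorff|exact: median_threshold_cvg].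
have half0 : 0 <= 2^-1 :> R by rewrite invr_ge0.
have half1 : 2^-1 <= 1 :> R by rewrite invf_le1 ?ler1n.
split; [exact: sharp_threshold|exact: median_threshold_cvg| | |].
- by move=> m _; exact: sat_prob_cvg1.
- by move=> m _; exact: sat_prob_cvg0.
by rewrite /classical_threshold_density !density1.
Qed.
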